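(* Let $r\ge1$, let $t_1,\dots,t_r$ be distinct complex numbers, none of which is an integer, and let $p_1,\dots,p_r\ge 1$ be integers whose sum is at least $2$. Let $R$ be a rational function whose denominator degree is at least two larger than its numerator degree, with partial fraction decomposition $$R(k)=\sum_{j=1}^r\sum_{i=1}^{p_j}\frac{C_{i,j}}{(k+t_j)^i},$$ where the $C_{i,j}$ are complex numbers with $C_{p_j,j}\neq 0$ for each $j$. Then $$\sum_{k=1}^\infty R(k)H_k=\sum_{j=1}^r\sum_{i=1}^{p_j}C_{i,j}\,T(t_j,i).$$
   Context: $H_k = 1+1/2+\cdots+1/k$ is the $k$th harmonic number. $\gamma$ is Euler's constant. $\psi(z)=\Gamma'(z)/\Gamma(z)$ is the digamma function (meromorphic on $\mathbb C$), and $\psi^{(n)}$ denotes its $n$-th derivative, with $\psi^{(0)}=\psi$. For $t$ not an integer and integer $p\ge1$, $$T(t,p)=\frac{(-1)^{p-1}}{2(p-1)!}\left(\psi^{(p)}(t)-2\gamma\,\psi^{(p-1)}(t)-\sum_{k=0}^{p-1}\binom{p-1}{k}\psi^{(k)}(t)\,\psi^{(p-1-k)}(t)\right).$$ *)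

(* Defs.v *)
From mathcomp Require Import all_boot all_order all_algebra.
From mathcomp Require Import complex.
From mathcomp Require Import all_classical all_reals all_analysis.
Set Implicit Arguments.
Unset Strict Implicit.
Unset Printing Implicit Defensive.
Import Order.TTheory GRing.Theory Num.Theory numFieldNormedType.Exports.
Local Open Scope classical_set_scope.
Local Open Scope ring_scope.

(* Typed as a numClosedFieldType so that it carries the norm topology, for
   which [derive1] is the complex derivative; R[i] alone has no topology. *)
Definition Cplx (R : realType) : numClosedFieldType := R[i].

Definition toC (R : realType) (x : R) : Cplx R := (x%:C)%C.

Definition cexp (R : realType) (z : Cplx R) : Cplx R :=
  toC (expR (complex.Re z)) *
  (cos (complex.Im z) +i* sin (complex.Im z))%C.

Definition harmonic_number (F : fieldType) (k : nat) : F :=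
  \sum_(1 <= i < k.+1) i%:R^-1.

Definition euler_gamma (R : realType) : R :=
  limn (fun n : nat => harmonic_number R n - ln n%:R).

(* Euler's limit n! n^z / (z (z + 1) ... (z + n)), where n^z = exp (z ln n):
   it converges at every z that is not a non-positive integer, so no analytic
   continuation is needed. The values at the poles are unspecified. *)
Definition Gamma (R : realType) (z : Cplx R) : Cplx R :=
  limn (fun n : nat =>
    n`!%:R * cexp (z * toC (ln n%:R)) / \prod_(0 <= k < n.+1) (z + k%:R)
    : Cplx R).

Definition digamma (R : realType) (z : Cplx R) : Cplx R :=
  derive1 (@Gamma R) z / Gamma z.

Definition polygamma (R : realType) (n : nat) : Cplx R -> Cplx R :=
  derive1n n (@digamma R).

Definition T (R : realType) (t : Cplx R) (p : nat) : Cplx R :=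
  (-1) ^+ p.-1 / (2%:R * (p.-1)`!%:R) *
  (polygamma p t - 2%:R * toC (euler_gamma R) * polygamma p.-1 t
   - \sum_(0 <= k < p)
       'C(p.-1, k)%:R * polygamma k t * polygamma (p.-1 - k)%N t).

(* f is a rational function, given by its values, whose denominator degree
   exceeds its numerator degree by at least d. Only the values where the
   denominator does not vanish are prescribed, so P / Q need not be in lowest
   terms. As size = degree + 1, the size gap is the degree gap. *)
Definition rational_with_degree_gap (F : fieldType) (d : nat) (f : F -> F) :=
  exists P Q : {poly F},
    [/\ Q != 0, (size P + d <= size Q)%N
      & forall z, Q.[z] != 0 -> f z = P.[z] / Q.[z]].

(* Main.v *)
(* Put a_k = 1/(t+k), S_i(N) = sum_(k <= N) a_k^i and p >= 1. For k <> l the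
   identity a_k - a_l = a_k a_l (l - k) gives
     sum_(1 <= i <= p) a_k^i a_l^(p+1-i) = (a_k^p - a_l^p) / (l - k),
   and summing over all k, l <= N yields the exact formula
     sum_(1 <= i <= p) S_i S_(p+1-i)
       = p S_(p+1) + 2 sum_(k <= N) a_k^p (H_(N-k) - H_k).
   Replacing S_1 by S_1 - H_N, which tends to - psi(t) - gamma, this expresses
   sum_k a_k^p H_k as a quantity tending to T(t,p), up to the constant gamma^2/2
   and the divergent term H_N^2/2, both for p = 1 only, and up to a remainder
   sum_k a_k^p (H_N - H_(N-k)). In the combination given by the partial fractions
   of R the two extra terms cancel, because the degree gap forces
   sum_j C_(1,j) = 0; for the same reason R(k) = O(1/k^2), whence the combined
   remainder is O(H_N / N).
   The values of the polygamma functions come from Euler's products: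
   Gamma_n(z+h) = Gamma_n(z) exp(h psi_n(z)) prod_(k <= n) (1 + h a_k)^-1 e^(h a_k)
   with psi_n(z) = ln n - sum_(k <= n) a_k, and the last product is 1 + O(h^2)
   uniformly in n, so Gamma' = Gamma lim psi_n can be read off directly; the higher
   derivatives follow from similar uniform second-order bounds. *)

Require Import Defs.
From mathcomp Require Import all_boot all_order all_algebra.
From mathcomp Require Import all_classical all_reals all_analysis.
From mathcomp Require Import complex ring lra.
Import Order.TTheory GRing.Theory Num.Theory numFieldNormedType.Exports.
Local Open Scope classical_set_scope.
Local Open Scope ring_scope.

(** * Sequences and series of complex numbers *)

(** In [Cplx R] the norm [|z|] is itself a complex number. Taking its real part moves every estimate
    into [R], where the order is total and [lra] and [nra] apply. *)
Definition nrm {R : realType} (z : Cplx R) : R := complex.Re `|z|.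

Section ComplexNorm.
Context {R : realType}.
Implicit Types (x y : R) (z w l : Cplx R).

Lemma toC_nat n : toC n%:R = n%:R :> Cplx R. Proof. exact: (rmorph_nat (real_complex R)). Qed.
Lemma toC0 : toC 0 = 0 :> Cplx R. Proof. by []. Qed.
Lemma toC1 : toC 1 = 1 :> Cplx R. Proof. by []. Qed.
Lemma toCD x y : toC (x + y) = toC x + toC y. Proof. exact: (rmorphD (real_complex R)). Qed.
Lemma toCB x y : toC (x - y) = toC x - toC y. Proof. exact: (rmorphB (real_complex R)). Qed.
Lemma toCN x : toC (- x) = - toC x. Proof. exact: (rmorphN (real_complex R)). Qed.
Lemma toCM x y : toC (x * y) = toC x * toC y. Proof. exact: (rmorphM (real_complex R)). Qed.
Lemma toCV x : toC x^-1 = (toC x)^-1. Proof. exact: (fmorphV (real_complex R)). Qed.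
Lemma toC_inj : injective (@toC R). Proof. by move=> x y []. Qed.
Lemma toC_le x y : (toC x <= toC y) = (x <= y). Proof. exact: lecR. Qed.
Lemma toC_lt x y : (toC x < toC y) = (x < y). Proof. exact: ltcR. Qed.

Lemma toC_sum I (s : seq I) (P : pred I) (F : I -> R) :
  toC (\sum_(i <- s | P i) F i) = \sum_(i <- s | P i) toC (F i).
Proof. exact: (rmorph_sum (real_complex R)). Qed.

Lemma toC_harmonic n : toC (harmonic_number R n) = harmonic_number (Cplx R) n.
Proof.
rewrite toC_sum; apply: eq_bigr => i _.
by rewrite toCV toC_nat.
Qed.

Lemma toC_nrm z : toC (nrm z) = `|z|.
Proof. exact: (RRe_real (normr_real z)). Qed.

Lemma nrm_ge0 z : 0 <= nrm z.
Proof. by rewrite -toC_le toC_nrm toC0. Qed.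

Lemma nrm0 : nrm (0 : Cplx R) = 0.
Proof. by apply: toC_inj; rewrite toC_nrm normr0. Qed.

Lemma nrm1 : nrm (1 : Cplx R) = 1.
Proof. by apply: toC_inj; rewrite toC_nrm normr1. Qed.

Lemma nrm_eq0 z : (nrm z == 0) = (z == 0).
Proof. by rewrite -(inj_eq toC_inj) toC_nrm toC0 normr_eq0. Qed.

Lemma nrm_gt0 z : (0 < nrm z) = (z != 0).
Proof. by rewrite lt_neqAle eq_sym nrm_eq0 nrm_ge0 andbT. Qed.

Lemma nrmN z : nrm (- z) = nrm z.
Proof. by apply: toC_inj; rewrite !toC_nrm normrN. Qed.

Lemma nrmBC z w : nrm (z - w) = nrm (w - z).
Proof. by rewrite -nrmN opprB. Qed.

Lemma nrmM z w : nrm (z * w) = nrm z * nrm w.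
Proof. by apply: toC_inj; rewrite toCM !toC_nrm normrM. Qed.

Lemma nrmV z : nrm z^-1 = (nrm z)^-1.
Proof. by apply: toC_inj; rewrite toCV !toC_nrm normfV. Qed.

Lemma nrmX z n : nrm (z ^+ n) = nrm z ^+ n.
Proof. by elim: n => [|n IH]; rewrite ?expr0 ?nrm1// !exprS nrmM IH. Qed.

Lemma nrmD z w : nrm (z + w) <= nrm z + nrm w.
Proof. by rewrite -toC_le toCD !toC_nrm ler_normD. Qed.

Lemma nrmBl z w : nrm z - nrm w <= nrm (z - w).
Proof. by rewrite lerBlDr (le_trans _ (nrmD _ _))// subrK. Qed.

Lemma nrm_toC x : nrm (toC x) = `|x|.
Proof.
apply: toC_inj; rewrite toC_nrm.
have [x0|x0] := leP 0 x; first by rewrite (ger0_norm x0) ger0_norm// -toC0 toC_le.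
by rewrite (ltr0_norm x0) toCN ltr0_norm// -toC0 toC_lt.
Qed.

Lemma nrm_nat n : nrm (n%:R : Cplx R) = n%:R.
Proof. by rewrite -toC_nat nrm_toC ger0_norm. Qed.

Lemma nrm_sum I (s : seq I) (P : pred I) (F : I -> Cplx R) :
  nrm (\sum_(i <- s | P i) F i) <= \sum_(i <- s | P i) nrm (F i).
Proof.
elim/big_ind2: _ => [|a b c d|//]; first by rewrite nrm0.
by move=> h1 h2; apply: (le_trans (nrmD _ _)); apply: lerD.
Qed.

Lemma Re_le_nrm z : `|complex.Re z| <= nrm z.
Proof. by rewrite -toC_le toC_nrm normc_ge_Re. Qed.

Lemma nrmE z : nrm z = Num.sqrt (complex.Re z ^+ 2 + complex.Im z ^+ 2).
Proof. by rewrite /nrm normc_def. Qed.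

Lemma Im_le_nrm z : `|complex.Im z| <= nrm z.
Proof. by rewrite nrmE -sqrtr_sqr ler_wsqrtr // lerDr sqr_ge0. Qed.

Lemma Re_add z w : complex.Re (z + w) = complex.Re z + complex.Re w.
Proof. by case: z; case: w. Qed.
Lemma Im_add z w : complex.Im (z + w) = complex.Im z + complex.Im w.
Proof. by case: z; case: w. Qed.

Lemma ReIm z : z = toC (complex.Re z) + ('i)%C * toC (complex.Im z).
Proof. exact: complexE. Qed.

Lemma nrm_i : nrm ('i%C : Cplx R) = 1.
Proof. by rewrite nrmE /= expr0n expr1n add0r sqrtr1. Qed.

Lemma nrm_le_ReIm z : nrm z <= `|complex.Re z| + `|complex.Im z|.
Proof.
by rewrite {1}(ReIm z) (le_trans (nrmD _ _))// nrmM !nrm_toC nrm_i mul1r.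
Qed.

Lemma cvgC_nrm T (F : set_system T) (FF : Filter F) (u : T -> Cplx R) (l : Cplx R) :
  u x @[x --> F] --> l <-> nrm (u x - l) @[x --> F] --> (0 : R).
Proof.
split=> [/cvgrPdist_lt h|/cvgrPdist_lt h]; apply/cvgrPdist_lt => e e0.
  have e0' : 0 < toC e by rewrite -toC0 toC_lt.
  have := h _ e0'; apply: filterS => x; rewrite -toC_nrm toC_lt => ux.
  by rewrite sub0r normrN ger0_norm ?nrm_ge0// nrmBC.
(* A positive element of [Cplx R] is real, so the tolerance [e] comes from a real one. *)
have er : e = toC (complex.Re e) by rewrite /toC RRe_real // gtr0_real.
have e0' : 0 < complex.Re e by rewrite -toC_lt toC0 -er.
have := h _ e0'; apply: filterS => x.
by rewrite sub0r normrN ger0_norm ?nrm_ge0// nrmBC -toC_nrm er toC_lt.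
Qed.

Lemma cvgC_le (u : nat -> Cplx R) l (v : nat -> R) :
  (forall n, nrm (u n - l) <= v n) -> v @ \oo --> (0 : R) -> u @ \oo --> l.
Proof.
move=> uv v0; apply/cvgC_nrm.
apply: (@squeeze_cvgr _ _ _ _ (fun=> 0) v) => //; last exact: cvg_cst.
by apply: nearW => n /=; rewrite nrm_ge0 uv.
Qed.

Lemma cvg_toC (u : nat -> R) (l : R) :
  u @ \oo --> l -> (fun n => toC (u n)) @ \oo --> toC l.
Proof.
move=> ul; apply/cvgC_nrm.
have -> : (fun n => nrm (toC (u n) - toC l)) = (fun n => `|u n - l|).
  by apply/funext => n; rewrite -toCB nrm_toC.
have : (fun n => u n - l) @ \oo --> l - l by apply: cvgB => //; exact: cvg_cst.
by rewrite subrr => /cvg_norm; rewrite normr0.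
Qed.

Lemma cvg_nrm (u : nat -> Cplx R) l : u @ \oo --> l -> (fun n => nrm (u n)) @ \oo --> nrm l.
Proof.
move/cvgC_nrm => h; apply/cvgrPdist_lt => e e0.
move/cvgrPdist_lt: h => /(_ _ e0); apply: filterS => n.
rewrite sub0r normrN ger0_norm ?nrm_ge0//; apply: le_lt_trans.
rewrite ler_norml nrmBC nrmBl andbT lerNl opprB nrmBC.
exact: nrmBl.
Qed.

Lemma cvgC_ReIm (u : nat -> Cplx R) (x y : R) :
  (fun n => complex.Re (u n)) @ \oo --> x ->
  (fun n => complex.Im (u n)) @ \oo --> y ->
  u @ \oo --> (toC x + 'i%C * toC y : Cplx R).
Proof.
move=> /cvg_toC ux /cvg_toC uy.
have -> : u = (fun n => toC (complex.Re (u n)) + 'i%C * toC (complex.Im (u n))).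
  by apply/funext => n; rewrite -ReIm.
exact: (cvgD ux (cvgM (cvg_cst _) uy)).
Qed.

Lemma le_lim_nrm (u : nat -> Cplx R) l (M : R) :
  u @ \oo --> l -> (forall n, nrm (u n) <= M) -> nrm l <= M.
Proof.
move=> /cvg_nrm ul uM; rewrite -(cvg_lim _ ul)//.
apply: limr_le; first by apply/cvg_ex; exists (nrm l).
exact: nearW.
Qed.

Lemma cvgC_bounded (u : nat -> Cplx R) l :
  u @ \oo --> l -> exists2 M : R, 0 < M & forall n, nrm (u n) <= M.
Proof.
move=> /cvg_nrm ul.
have /cvg_seq_bounded : cvg ((fun n => nrm (u n)) @ \oo) by apply/cvg_ex; exists (nrm l).
move=> [M [Mr hM]].
exists (`|M| + 1) => [|n]; first by rewrite ltr_wpDl.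
have /hM/(_ n I) : M < `|M| + 1 by rewrite (le_lt_trans (ler_norm _))// ltrDl.
exact: le_trans (ler_norm _).
Qed.

(** Real and imaginary parts are additive and dominated by [nrm], so each gives an absolutely
    convergent real series. *)
Lemma summableC_cvg (u : nat -> Cplx R) (M : R) :
  (forall n, \sum_(0 <= k < n) nrm (u k) <= M) ->
  exists l, (fun n => \sum_(0 <= k < n) u k) @ \oo --> l.
Proof.
move=> uM.
have real_part (f : Cplx R -> R) : {morph f : z w / z + w >-> z + w} ->
    (forall z, `|f z| <= nrm z) ->
    exists l : R, (fun n => f (\sum_(0 <= k < n) u k)) @ \oo --> l.
  move=> fD f_le.
  have f0 : f 0 = 0 by apply/eqP; rewrite -normr_le0 (le_trans (f_le _))// nrm0.
  have -> : (fun n => f (\sum_(0 <= k < n) u k)) = series (fun k => f (u k)).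
    apply/funext => n; rewrite seriesEnat /=.
    by rewrite (big_morph f fD f0).
  apply/cvg_ex; apply: (@normed_cvg _ R).
  apply: (@series_le_cvg _ _ (fun k => nrm (u k))) => [k|k|k|] /=.
  - exact: normr_ge0.
  - exact: nrm_ge0.
  - exact: f_le.
  apply: nondecreasing_is_cvgn.
    by apply: nondecreasing_series => k _ _; exact: nrm_ge0.
  by exists M => _ [n _ <-]; rewrite seriesEnat /=.
have [x hx] := real_part _ Re_add Re_le_nrm.
have [y hy] := real_part _ Im_add Im_le_nrm.
by exists (toC x + 'i%C * toC y); exact: cvgC_ReIm.
Qed.

End ComplexNorm.

(** * The complex exponential near 0 *)

Section ComplexExp.
Context {R : realType}.
Implicit Types (x y : R) (z w : Cplx R).

(** The intermediate point serves twice: |cos c| <= 1 gives |sin y| <= |y|, and |c| <= |y| controls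
    sin y - y = (cos c - 1) y. *)
Lemma sin_MVT y : exists2 c : R, `|c| <= `|y| & sin y = cos c * y.
Proof.
have pos x : 0 <= x -> exists2 c : R, `|c| <= `|x| & sin x = cos c * x.
  move=> x0; have [|c cx] := @MVT_segment R sin cos 0 x x0 (fun t _ => is_derive_sin t).
    by apply: continuous_subspaceT; exact: continuous_sin.
  rewrite sin0 !subr0 => e; exists c => //.
  by move: cx; rewrite in_itv /= => /andP[c0 cx]; rewrite !ger0_norm.
have [/pos//|y0] := leP 0 y.
have [|c cy e] := pos (- y); first by rewrite oppr_ge0 ltW.
exists c; first by rewrite -(normrN y).
by apply: oppr_inj; rewrite -sinN e mulrN.
Qed.

Lemma sin_le_norm y : `|sin y| <= `|y|.
Proof.
have [c _ ->] := sin_MVT y.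
by rewrite normrM ler_piMl// cos_max.
Qed.

Lemma cosB1_le y : `|cos y - 1| <= y ^+ 2 / 2.
Proof.
have -> : cos y = cos ((y / 2) *+ 2) by congr cos; rewrite mulr2n -splitr.
rewrite cos_mulr2n cos2sin2.
have -> : (1 - sin (y / 2) ^+ 2) *+ 2 - 1 - 1 = - (2 * `|sin (y / 2)| ^+ 2).
  by rewrite real_normK ?num_real//; ring.
rewrite normrN ger0_norm ?mulr_ge0//.
have := sin_le_norm (y / 2).
rewrite -(@ler_pXn2r _ 2)// ?nnegrE// => h.
apply: (le_trans (ler_wpM2l _ h)) => //.
by rewrite real_normK ?num_real//; lra.
Qed.

Lemma sinB_le y : `|y| <= 1 -> `|sin y - y| <= y ^+ 2 / 2.
Proof.
move=> y1; have [c cy ->] := sin_MVT y.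
have -> : cos c * y - y = (cos c - 1) * y by ring.
rewrite normrM.
have h : `|cos c - 1| <= y ^+ 2 / 2.
  apply: (le_trans (cosB1_le c)).
  rewrite ler_pM2r ?invr_gt0// -(real_normK (num_real c)) -(real_normK (num_real y)).
  by rewrite ler_pXn2r// ?nnegrE.
by apply: (le_trans (ler_pM _ _ h y1)); rewrite ?mulr1.
Qed.

(** From e^x >= 1 + x at x and at -x one gets 1 + x <= e^x <= 1 / (1 - x), and x^2 / (1 - x) <= 2
    x^2 for x <= 1/2. *)
Lemma expRB1_le x : `|x| <= 2^-1 -> `|expR x - 1 - x| <= 2 * x ^+ 2.
Proof.
rewrite ler_norml => /andP[x1 x2].
have h1 := expR_ge1Dx x; have h2 := expR_ge1Dx (- x).
have e0 := expR_gt0 x.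
have h3 : expR x * (1 - x) <= 1.
  by rewrite -[leRHS](expRxMexpNx_1 x) ler_pM2l.
rewrite ler_norml; apply/andP; split; nra.
Qed.

Lemma cexpD z w : cexp (z + w) = cexp z * cexp w.
Proof.
case: z => a b; case: w => c d; rewrite /cexp /toC /=.
rewrite expRD cosD sinD; simpc.
by apply/eqP; rewrite eq_complex /=; apply/andP; split; apply/eqP; ring.
Qed.

Lemma cexp0 : cexp (0 : Cplx R) = 1.
Proof. by rewrite /cexp /toC /= expR0 cos0 sin0 mul1r. Qed.

Lemma cexp_toC x : cexp (toC x) = toC (expR x).
Proof. by rewrite /cexp /toC /= cos0 sin0 mulr1. Qed.

Lemma cexpN z : cexp (- z) = (cexp z)^-1.
Proof.
have e : cexp z * cexp (- z) = 1 by rewrite -cexpD subrr cexp0.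
have : cexp z != 0.
  by apply/eqP => z0; move/eqP: e; rewrite z0 mul0r eq_sym oner_eq0.
by move=> z0; apply: (mulfI z0); rewrite e divff.
Qed.

Lemma cexp_neq0 z : cexp z != 0.
Proof.
apply/eqP => z0; have := cexpD z (- z).
by rewrite subrr cexp0 z0 mul0r => /eqP; rewrite oner_eq0.
Qed.

(** With r = |w|, real and imaginary parts split into four terms, bounded by r^2, 2 r^2, r^2 and 2
    r^2; the constant 8 leaves room. *)
Lemma cexpB1B_le w : nrm w <= 2^-1 -> nrm (cexp w - 1 - w) <= 8 * nrm w ^+ 2.
Proof.
move=> w1.
have hx := Re_le_nrm w; have hy := Im_le_nrm w.
case: w w1 hx hy => x y; set r := nrm _ => r1 /= hx hy.
apply: (le_trans (nrm_le_ReIm _)).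
have -> : complex.Re (cexp (x +i* y)%C - 1 - (x +i* y)%C) =
   expR x * (cos y - 1) + (expR x - 1 - x) by rewrite /cexp /=; ring.
have -> : complex.Im (cexp (x +i* y)%C - 1 - (x +i* y)%C) =
   expR x * (sin y - y) + (expR x - 1) * y by rewrite /cexp /=; ring.
have r0 : 0 <= r := nrm_ge0 _.
have x2 : x ^+ 2 <= r ^+ 2 by rewrite -(real_normK (num_real x)) ler_pXn2r// ?nnegrE.
have y2 : y ^+ 2 <= r ^+ 2 by rewrite -(real_normK (num_real y)) ler_pXn2r// ?nnegrE.
have x1 := le_trans hx r1; have y1 := le_trans hy r1.
have ex := expRB1_le _ x1.
have ex2 : `|expR x| <= 2.
  rewrite ger0_norm ?expR_ge0//.
  have := ler_norm (expR x - 1 - x); have := ler_norm x; nra.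
have cy := cosB1_le y.
have sy : `|sin y - y| <= y ^+ 2 / 2 by apply: sinB_le; lra.
have c1 : `|expR x * (cos y - 1)| <= 2 * (r ^+ 2 / 2).
  by rewrite normrM; apply: ler_pM => //; lra.
have c2 : `|expR x * (sin y - y)| <= 2 * (r ^+ 2 / 2).
  by rewrite normrM; apply: ler_pM => //; lra.
have c3 : `|(expR x - 1) * y| <= 2 * r * r.
  rewrite normrM; apply: ler_pM => //.
  have -> : expR x - 1 = (expR x - 1 - x) + x by ring.
  apply: (le_trans (ler_normD _ _)); nra.
have d1 := ler_normD (expR x * (cos y - 1)) (expR x - 1 - x).
have d2 := ler_normD (expR x * (sin y - y)) ((expR x - 1) * y).
nra.
Qed.

End ComplexExp.

(** * Series and products with terms of order 1/k^2 *)

Section Summability.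
Context {R : realType}.
Implicit Types (z w l : Cplx R).

Definition decay2 (u : nat -> Cplx R) :=
  exists C : R, forall k, nrm (u k) <= C / k.+1%:R ^+ 2.

Lemma sum_inv_sqr_le2 n : \sum_(0 <= k < n) (k.+1%:R ^+ 2)^-1 <= 2 :> R.
Proof.
(* The strengthened bound 2 - 1/(m + 1) makes the induction telescope, by 1/(x + 1)^2 <= 1/x - 1/(x
   + 1). *)
suff h m : \sum_(0 <= k < m.+1) (k.+1%:R ^+ 2)^-1 <= 2 - m.+1%:R^-1 :> R.
  case: n => [|n]; first by rewrite big_nil.
  by apply: (le_trans (h n)); rewrite gerBl invr_ge0.
elim: m => [|m IH]; first by rewrite big_nat1 expr1n invr1; lra.
rewrite big_nat_recr//=.
have m0 : 0 < m.+1%:R :> R by rewrite ltr0n.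
have e : m.+2%:R = m.+1%:R + 1 :> R by rewrite -natr1.
have : (m.+2%:R ^+ 2)^-1 <= m.+1%:R^-1 - m.+2%:R^-1 :> R.
  rewrite e; set x : R := m.+1%:R in m0 *.
  have -> : x^-1 - (x + 1)^-1 = (x * (x + 1))^-1 by field; apply/andP; split; lra.
  by rewrite lef_pV2 ?posrE; nra.
move=> h; apply: (le_trans (lerD IH h)).
by rewrite addrA subrK.
Qed.

Lemma decay2_sum_le u : decay2 u ->
  exists2 M : R, 0 <= M & forall n, \sum_(0 <= k < n) nrm (u k) <= M.
Proof.
move=> [C hC]; have C0 : 0 <= C.
  by have := le_trans (nrm_ge0 _) (hC 0%N); rewrite expr1n divr1.
exists (C * 2) => [|n]; first by rewrite mulr_ge0.
have : \sum_(0 <= k < n) nrm (u k) <= C * \sum_(0 <= k < n) (k.+1%:R ^+ 2)^-1.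
  by rewrite mulr_sumr; apply: ler_sum => k _; exact: hC.
by move/le_trans; apply; rewrite ler_wpM2l// sum_inv_sqr_le2.
Qed.

Lemma decay2_cvg u : decay2 u -> exists l, (fun n => \sum_(0 <= k < n) u k) @ \oo --> l.
Proof. by move=> /decay2_sum_le[M _ hM]; exact: summableC_cvg hM. Qed.

Lemma decay2_eventually u (C : R) (K : nat) :
  (forall k, (K <= k)%N -> nrm (u k) <= C / k.+1%:R ^+ 2) -> decay2 u.
Proof.
(* The added sum contains each exceptional term scaled by (k + 1)^2, so it covers all k < K at
   once. *)
move=> h; exists (`|C| + \sum_(0 <= k < K) nrm (u k) * k.+1%:R ^+ 2) => k.
have k0 : 0 < k.+1%:R ^+ 2 :> R by rewrite exprn_gt0// ltr0n.
rewrite ler_pdivlMr//.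
have s0 : 0 <= \sum_(0 <= k < K) nrm (u k) * k.+1%:R ^+ 2.
  by apply: sumr_ge0 => i _; rewrite mulr_ge0 ?nrm_ge0 ?exprn_ge0.
have [Kk|kK] := leqP K k.
  have := h _ Kk; rewrite ler_pdivlMr// => /le_trans; apply.
  by rewrite (le_trans (ler_norm C))// lerDl.
rewrite (big_rem k) ?mem_index_iota//= addrCA lerDl addr_ge0//.
by apply: sumr_ge0 => i _; rewrite mulr_ge0 ?nrm_ge0 ?exprn_ge0.
Qed.

Lemma prod_sub1_nrm (w : nat -> Cplx R) n :
  nrm (\prod_(0 <= k < n) (1 + w k) - 1) <= expR (\sum_(0 <= k < n) nrm (w k)) - 1.
Proof.
elim: n => [|n IH]; first by rewrite !big_nil subrr nrm0 expR0 subrr.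
rewrite !big_nat_recr//=; set P := \prod_(_ <= _ < _) _ in IH *.
set S := \sum_(_ <= _ < _) _ in IH *.
have -> : P * (1 + w n) - 1 = (P - 1) * (1 + w n) + w n by ring.
apply: (le_trans (nrmD _ _)); rewrite nrmM expRD.
have h1 := nrmD 1 (w n); rewrite nrm1 in h1.
have h2 := expR_ge1Dx (nrm (w n)).
have h3 := nrm_ge0 (w n); have h4 := nrm_ge0 (P - 1); have h5 := nrm_ge0 (1 + w n).
have h6 := expR_gt0 S.
have : nrm (P - 1) * nrm (1 + w n) <= (expR S - 1) * (1 + nrm (w n)).
  by apply: ler_pM.
nra.
Qed.

(** The partial products satisfy P (n + 1) - P n = P n * w n and are bounded, so the product is 1
    plus an absolutely convergent series. *)
Lemma decay2_prod_cvg (w : nat -> Cplx R) : decay2 w ->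
  exists l, (fun n => \prod_(0 <= k < n) (1 + w k)) @ \oo --> l.
Proof.
move=> /decay2_sum_le[M M0 hM].
pose P n := \prod_(0 <= k < n) (1 + w k).
have Pb n : nrm (P n) <= expR M.
  have -> : P n = (P n - 1) + 1 by ring.
  apply: (le_trans (nrmD _ _)); rewrite nrm1 -lerBrDr.
  by apply: (le_trans (prod_sub1_nrm _ _)); rewrite lerB// ler_expR.
have [l hl] : exists l, (fun n => \sum_(0 <= k < n) P k * w k) @ \oo --> l.
  apply: (@summableC_cvg _ _ (expR M * M)) => n.
  apply: (@le_trans _ _ (\sum_(0 <= k < n) expR M * nrm (w k))).
    by apply: ler_sum => k _; rewrite nrmM ler_wpM2r ?nrm_ge0.
  by rewrite -mulr_sumr ler_wpM2l ?expR_ge0.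
exists (1 + l).
have -> : (fun n => \prod_(0 <= k < n) (1 + w k)) =
          (fun n => 1 + \sum_(0 <= k < n) P k * w k).
  apply/funext; elim=> [|n IH]; first by rewrite !big_nil addr0.
  by rewrite big_nat_recr//= [in RHS]big_nat_recr//= addrA -IH mulrDr mulr1.
exact: (cvgD (cvg_cst _) hl).
Qed.

End Summability.

(** * Complex derivatives from second-order remainder bounds *)

Section Derivatives.
Context {R : realType}.
Implicit Types (z w l : Cplx R).

Lemma derive1_quadratic (F : Cplx R -> Cplx R) z d (K delta : R) : 0 < delta ->
  (forall h, nrm h < delta -> nrm (F (z + h) - F z - h * d) <= K * nrm h ^+ 2) ->
  derive1 F z = d.
Proof.
move=> delta0 hF; rewrite /derive1; apply: cvg_lim => //.
apply/cvgC_nrm; apply/cvgrPdist_lt => e e0.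
(* [K] may be zero or negative, so the radius below divides by [|K| + 1]. *)
have K0 : 0 < `|K| + 1 by rewrite ltr_wpDl.
near=> h.
have h0 : h != 0 by near: h; exact: nbhs_dnbhs_neq.
have hnear : nrm h < Num.min delta (e / (`|K| + 1)).
  near: h; apply: nbhs_dnbhs.
  have m0 : 0 < toC (Num.min delta (e / (`|K| + 1))).
    by rewrite -toC0 toC_lt lt_min delta0 divr_gt0.
  apply: filterS (nbhsx_ballx (0 : Cplx R) _ m0) => y.
  by rewrite -ball_normE /= sub0r normrN -toC_nrm toC_lt.
move: hnear; rewrite lt_min => /andP[hd he].
have nh0 : 0 < nrm h by rewrite nrm_gt0.
rewrite sub0r normrN ger0_norm ?nrm_ge0//.
have -> : h^-1 *: (F (h + z) - F z) - d = h^-1 * (F (z + h) - F z - h * d).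
  by rewrite -[_ *: _]/(_ * _) (addrC h) [RHS]mulrBr mulKf.
rewrite nrmM nrmV.
rewrite mulrC ltr_pdivrMr// (le_lt_trans (hF _ hd))//.
rewrite expr2 mulrA ltr_pM2r//.
move: he; rewrite ltr_pdivlMr//; have := ler_norm K; nra.
Unshelve. all: by end_near. Qed.

(* Replaces uniform convergence of derivatives: the quadratic remainder bound is
   uniform in n and survives the limit. *)
Lemma derive1_limit (Fn : nat -> Cplx R -> Cplx R) (F : Cplx R -> Cplx R)
    (Gn : nat -> Cplx R) z d (K delta : R) : 0 < delta ->
  (forall h, nrm h < delta -> (fun n => Fn n (z + h)) @ \oo --> F (z + h)) ->
  Gn @ \oo --> d ->
  (forall n h, nrm h < delta ->
     nrm (Fn n (z + h) - Fn n z - h * Gn n) <= K * nrm h ^+ 2) ->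
  derive1 F z = d.
Proof.
move=> delta0 cF cG hF; apply: (@derive1_quadratic F z d K delta) => // h hd.
have cz : (fun n => Fn n z) @ \oo --> F z.
  by have := cF 0; rewrite nrm0 !addr0; apply.
apply: (@le_lim_nrm _ (fun n => Fn n (z + h) - Fn n z - h * Gn n)); last first.
  by move=> n; exact: hF.
exact: (cvgB (cvgB (cF _ hd) cz) (cvgM (cvg_cst h) cG)).
Qed.

End Derivatives.

(** * Euler's constant and sums of powers of 1/(z + k) *)

Section EulerConstant.
Context {R : realType}.

Lemma harmonic_numberS (F : fieldType) n :
  harmonic_number F n.+1 = harmonic_number F n + n.+1%:R^-1.
Proof. by rewrite /harmonic_number big_nat_recr. Qed.

Lemma harmonic_numberE (F : fieldType) n :
  harmonic_number F n = \sum_(0 <= k < n) k.+1%:R^-1.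
Proof. by rewrite /harmonic_number big_add1. Qed.

Lemma ln_succ_sub n : ln n.+2%:R - ln n.+1%:R <= n.+1%:R^-1 :> R.
Proof.
have p1 : 0 < n.+1%:R :> R by rewrite ltr0n.
rewrite -ln_div ?posrE ?ltr0n//.
have -> : n.+2%:R / n.+1%:R = 1 + n.+1%:R^-1 :> R.
  by rewrite -natr1 mulrDl divff ?gt_eqF// mul1r.
by apply: le_ln1Dx; rewrite (@lt_trans _ _ 0)// invr_gt0.
Qed.

Lemma ln_succ_sub_ge n : n.+2%:R^-1 <= ln n.+2%:R - ln n.+1%:R :> R.
Proof.
have p1 : 0 < n.+2%:R :> R by rewrite ltr0n.
rewrite -lerN2 opprB -ln_div ?posrE ?ltr0n//.
have -> : n.+1%:R / n.+2%:R = 1 + - n.+2%:R^-1 :> R.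
  apply: (mulIf (lt0r_neq0 p1)); rewrite mulfVK ?gt_eqF// mulrDl mulNr mulVf ?gt_eqF//.
  by rewrite mul1r -(natr1 n.+1) addrK.
by apply: le_ln1Dx; rewrite ltrN2 invf_lt1// ltr1n.
Qed.

Lemma euler_gamma_cvg :
  (fun n => harmonic_number R n - ln n%:R) @ \oo --> euler_gamma R.
Proof.
rewrite /euler_gamma; apply: cvgP.
(* At n = 0 the sequence involves the default value of [ln 0]; monotonicity is shown from n = 1
   on. *)
suff /cvg_ex[l] : cvgn (fun n => harmonic_number R n.+1 - ln n.+1%:R).
  by rewrite (cvg_shiftS (fun n => harmonic_number R n - ln n%:R)) => hl; apply/cvg_ex; exists l.
apply: nonincreasing_is_cvgn.
  apply/nonincreasing_seqP => n.
  rewrite (harmonic_numberS _ n.+1) -addrA lerD2l lerBlDr addrC.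
  exact: ln_succ_sub_ge.
exists 0 => _ [n _ <-].
have : ln n.+1%:R <= harmonic_number R n.
  elim: n => [|n IH]; first by rewrite ln1 /harmonic_number big_geq.
  by rewrite harmonic_numberS -(subrK (ln n.+1%:R) (ln _)) addrC lerD// ln_succ_sub.
move=> h; rewrite subr_ge0 (le_trans h)// harmonic_numberS lerDl.
by rewrite invr_ge0.
Qed.

End EulerConstant.

Definition gamma_regular {R : realType} (z : Cplx R) := forall k, z + k%:R != 0.

Definition inv_pow_sum {R : realType} (i : nat) (z : Cplx R) (n : nat) : Cplx R :=
  \sum_(0 <= k < n.+1) (z + k%:R)^-1 ^+ i.

Section RegularPoints.
Context {R : realType}.
Implicit Types (z w l h : Cplx R).

Lemma inv_shift_le z : gamma_regular z ->
  exists2 B : R, 1 <= B & forall k, nrm (z + k%:R)^-1 <= B / k.+1%:R.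
Proof.
move=> gz.
(* For k >= 2|z| + 1 one has |z + k| >= k - |z| >= (k + 1)/2; the finitely many smaller k are
   absorbed in the constant. *)
pose K := Num.truncn (2 * nrm z + 1).
have hK k : (K < k)%N -> nrm (z + k%:R)^-1 <= 2 / k.+1%:R.
  move=> Kk; have r0 := nrm_ge0 z.
  have kr : 2 * nrm z + 1 <= k%:R.
    have := @truncnS_gt R (2 * nrm z + 1); rewrite -/K.
    by move/ltW/le_trans; apply; rewrite ler_nat.
  have p : 0 < k.+1%:R :> R by rewrite ltr0n.
  have := nrmBl k%:R (- z); rewrite nrmN opprK nrm_nat addrC => h.
  have e : k.+1%:R = k%:R + 1 :> R by rewrite -natr1.
  rewrite (addrC z) nrmV -[leRHS]invrK lef_pV2 ?posrE.
  - rewrite invf_div ler_pdivrMr//; lra.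
  - by lra.
  - by rewrite invr_gt0 divr_gt0.
exists (2 + \sum_(0 <= k < K.+1) nrm (z + k%:R)^-1 * k.+1%:R) => [|k].
  have : 0 <= \sum_(0 <= k < K.+1) nrm (z + k%:R)^-1 * k.+1%:R.
    by apply: sumr_ge0 => k _; rewrite mulr_ge0 ?nrm_ge0.
  by lra.
have p : 0 < k.+1%:R :> R by rewrite ltr0n.
rewrite ler_pdivlMr//.
have [kK|Kk] := leqP k K.
  rewrite (big_rem k) ?mem_index_iota//= addrCA lerDl addr_ge0//.
  by apply: sumr_ge0 => i _; rewrite mulr_ge0 ?nrm_ge0.
have := hK _ Kk; rewrite ler_pdivlMr// => /le_trans; apply.
by rewrite lerDl; apply: sumr_ge0 => i _; rewrite mulr_ge0 ?nrm_ge0.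
Qed.

Lemma inv_shift_bounded z : gamma_regular z ->
  exists2 B : R, 1 <= B & forall k, nrm (z + k%:R)^-1 <= B.
Proof.
move=> /inv_shift_le[B B1 hB]; exists B => // k.
apply: (le_trans (hB k)); rewrite ler_pdivrMr ?ltr0n// ler_peMr ?ler1n//.
by rewrite (le_trans _ B1).
Qed.

Lemma inv_shift_sqr_decay2 z w : gamma_regular z -> gamma_regular w ->
  decay2 (fun k => (z + k%:R)^-1 * (w + k%:R)^-1).
Proof.
move=> /inv_shift_le[B B1 hB] /inv_shift_le[C C1 hC]; exists (B * C) => k.
by rewrite nrmM expr2 invfM mulrACA; apply: ler_pM; rewrite ?nrm_ge0.
Qed.

Lemma decay2Ml c (u : nat -> Cplx R) : decay2 u -> decay2 (fun k => c * u k).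
Proof.
move=> [C hC]; exists (nrm c * C) => k.
by rewrite nrmM -mulrA ler_wpM2l ?nrm_ge0.
Qed.

Lemma decay2D (u v : nat -> Cplx R) : decay2 u -> decay2 v -> decay2 (fun k => u k + v k).
Proof.
move=> [C hC] [D hD]; exists (C + D) => k.
by rewrite mulrDl (le_trans (nrmD _ _))// lerD.
Qed.

Lemma inv_shift_pow_decay2 z i : gamma_regular z -> (2 <= i)%N ->
  decay2 (fun k => (z + k%:R)^-1 ^+ i).
Proof.
move=> gz; case: i => [//|[//|i _]].
have [B B1 hB] := inv_shift_bounded z gz.
have [C hC] := inv_shift_sqr_decay2 z z gz gz.
exists (B ^+ i * C) => k; rewrite -(addn2 i) exprD nrmM nrmX -mulrA.
apply: ler_pM; rewrite ?exprn_ge0 ?nrm_ge0//.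
  by rewrite lerXn2r ?nnegrE ?nrm_ge0// (le_trans _ B1).
by rewrite expr2.
Qed.

Lemma gamma_regular1 : gamma_regular (1 : Cplx R).
Proof. by move=> k; rewrite addrC natr1 pnatr_eq0. Qed.

Lemma shift_factor z h k : gamma_regular z ->
  z + h + k%:R = (z + k%:R) * (1 + h * (z + k%:R)^-1).
Proof. by move=> gz; rewrite mulrDr mulr1 mulrCA divff// mulr1 addrAC. Qed.

Lemma nrm_1D_ge h : nrm h <= 2^-1 -> 2^-1 <= nrm (1 + h).
Proof. by move=> h1; have := nrmBl 1 (- h); rewrite nrmN opprK nrm1; lra. Qed.

(** Regularity persists on a disc because |1 + h/(z + k)| >= 1/2 there for every k. Differentiating
    a function known only at regular points needs this. *)
Lemma gamma_regular_near z (B : R) h : gamma_regular z ->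
  (forall k, nrm (z + k%:R)^-1 <= B) -> nrm h * B <= 2^-1 -> gamma_regular (z + h).
Proof.
move=> gz hB hh k; rewrite shift_factor// mulf_neq0// -nrm_gt0.
apply: (@lt_le_trans _ _ 2^-1); first by rewrite invr_gt0.
apply: nrm_1D_ge; rewrite nrmM; apply: le_trans hh.
by rewrite ler_wpM2l ?nrm_ge0.
Qed.

End RegularPoints.

(** * The Gamma function as a limit of Euler products *)

(** This is the logarithmic derivative of [Gamma_approx] in z. *)
Definition psi_approx {R : realType} (z : Cplx R) (n : nat) : Cplx R :=
  toC (ln n%:R) - inv_pow_sum 1 z n.

Definition Gamma_approx {R : realType} (z : Cplx R) (n : nat) : Cplx R :=
  n`!%:R * cexp (z * toC (ln n%:R)) / \prod_(0 <= k < n.+1) (z + k%:R).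

(** Inverse of the Weierstrass primary factor of genus one at -u. The exponential cancels the
    first-order term, leaving 1 + O(u^2). *)
Definition genus1_factor {R : realType} (u : Cplx R) : Cplx R := (1 + u)^-1 * cexp u.

Section GammaFunction.
Context {R : realType}.
Implicit Types (z w l h : Cplx R).

Lemma eq_cvgC (u v : nat -> Cplx R) l :
  u @ \oo --> l -> (forall n, v n = u n) -> v @ \oo --> l.
Proof. by move=> ul uv; have -> : v = u by apply/funext. Qed.

Lemma cvg_cexp (u : nat -> Cplx R) l : u @ \oo --> l ->
  (fun n => cexp (u n)) @ \oo --> cexp l.
Proof.
move=> ul; have hv : (fun n => u n - l) @ \oo --> (0 : Cplx R).
  by rewrite -(subrr l); exact: (cvgB ul (cvg_cst _)).
suff h : (fun n => cexp (u n - l)) @ \oo --> (1 : Cplx R).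
  have -> : (fun n => cexp (u n)) = (fun n => cexp (u n - l) * cexp l).
    by apply/funext => n; rewrite -cexpD subrK.
  by rewrite -[X in _ --> X]mul1r; exact: (cvgM h (cvg_cst _)).
move: hv; set v := (fun n => u n - l); rewrite -[fun n => cexp _]/(fun n => cexp (v n)).
move=> /cvgC_nrm/cvgrPdist_lt hv; apply/cvgC_nrm/cvgrPdist_lt => e e0.
(* For |v| <= 1/2 the bound 8|v|^2 + |v| is at most 5|v|. *)
have m0 : 0 < Num.min 2^-1 (e / 5) :> R by rewrite lt_min; lra.
have := hv _ m0; apply: filterS => n.
rewrite !sub0r !normrN subr0 !ger0_norm ?nrm_ge0// lt_min => /andP[h1 h2].
have -> : cexp (v n) - 1 = (cexp (v n) - 1 - v n) + v n by ring.
have h3 := cexpB1B_le _ (ltW h1).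
apply: (le_lt_trans (nrmD _ _)).
have := nrm_ge0 (v n); nra.
Qed.

Lemma inv_pow_sum_cvg z i : gamma_regular z -> (2 <= i)%N ->
  exists l, inv_pow_sum i z @ \oo --> l.
Proof.
move=> gz i2; have [l hl] := decay2_cvg _ (inv_shift_pow_decay2 _ _ gz i2).
by exists l; move: hl; rewrite -cvg_shiftS.
Qed.

(** Pairing 1/(k + 1) with 1/(z + k) leaves (z - 1)/((z + k)(k + 1)), of order 1/k^2. [inv_pow_sum]
    has n + 1 terms against n in H_n, whence the vanishing correction 1/(n + 1). *)
Lemma harmonic_sub_cvg z : gamma_regular z ->
  exists l, (fun n => harmonic_number (Cplx R) n - inv_pow_sum 1 z n) @ \oo --> l.
Proof.
move=> gz.
have := decay2Ml (z - 1) _ (inv_shift_sqr_decay2 _ _ gz (@gamma_regular1 R)).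
move=> /decay2_cvg[l]; rewrite -cvg_shiftS => hl; exists l.
have hh : (fun n => toC (@harmonic R n)) @ \oo --> (0 : Cplx R).
  by rewrite -toC0; apply: cvg_toC; exact: cvg_harmonic.
rewrite -(subr0 l); apply: (eq_cvgC _ _ _ (cvgB hl hh)) => n; rewrite /inv_pow_sum.
rewrite -[RHS]/(\sum_(0 <= k < n.+1) (z - 1) * ((z + k%:R)^-1 * (1 + k%:R)^-1) - toC n.+1%:R^-1).
rewrite toCV toC_nat.
have -> : harmonic_number (Cplx R) n = harmonic_number (Cplx R) n.+1 - n.+1%:R^-1.
  by rewrite harmonic_numberS addrK.
rewrite addrAC harmonic_numberE -sumrB; congr (_ - _).
apply: eq_bigr => k _; rewrite expr1.
have g1 := @gamma_regular1 R k; rewrite -natr1 [k%:R + 1]addrC.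
have gk := gz k; by field; rewrite g1 gk.
Qed.

Lemma psi_approx_cvg z : gamma_regular z -> exists l, psi_approx z @ \oo --> l.
Proof.
move=> /harmonic_sub_cvg[l hl]; exists (l - toC (euler_gamma R)).
apply: (eq_cvgC _ _ _ (cvgB hl (cvg_toC _ _ (@euler_gamma_cvg R)))) => n.
rewrite -[RHS]/(_ - _ - _) toCB toC_harmonic /psi_approx.
by ring.
Qed.

Lemma cexp_sum n (u : nat -> Cplx R) :
  cexp (\sum_(0 <= k < n) u k) = \prod_(0 <= k < n) cexp (u k).
Proof.
elim: n => [|n IH]; first by rewrite !big_nil cexp0.
by rewrite !big_nat_recr//= cexpD IH.
Qed.

(** The factors e^(h/(z + k)) that make the product converge are taken out of n^h, which leaves
    exp(h psi_n(z)); both parts then converge separately. *)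
Lemma Gamma_approx_shift z h n : gamma_regular z ->
  Gamma_approx (z + h) n = Gamma_approx z n * (cexp (h * psi_approx z n) *
    \prod_(0 <= k < n.+1) genus1_factor (h * (z + k%:R)^-1)).
Proof.
move=> gz; rewrite /Gamma_approx /genus1_factor /psi_approx.
rewrite mulrDl cexpD mulrBr [cexp (_ - _)]cexpD cexpN.
have -> : h * inv_pow_sum 1 z n = \sum_(0 <= k < n.+1) h * (z + k%:R)^-1.
  by rewrite /inv_pow_sum mulr_sumr; apply: eq_bigr => k _; rewrite expr1.
rewrite cexp_sum [X in _ = _ * (_ * X)]big_split/= prodfV.
have -> : \prod_(0 <= k < n.+1) (z + h + k%:R) =
    (\prod_(0 <= k < n.+1) (z + k%:R)) * \prod_(0 <= k < n.+1) (1 + h * (z + k%:R)^-1).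
  by rewrite -big_split/=; apply: eq_bigr => k _; rewrite shift_factor.
set P := \prod_(_ <= _ < _) cexp _.
have P0 : P != 0.
  by rewrite /P prodf_seq_neq0; apply/allP => k _ /=; exact: cexp_neq0.
rewrite invfM.
set a := (\prod_(_ <= _ < _) _)^-1; set b := (\prod_(_ <= _ < _) _)^-1.
by field.
Qed.

Lemma genus1_factor_sub1_le (u : Cplx R) : nrm u <= 2^-1 ->
  nrm (genus1_factor u - 1) <= 16 * nrm u ^+ 2.
Proof.
move=> u1; have h := nrm_1D_ge _ u1.
have u0 : 1 + u != 0 by rewrite -nrm_gt0 (lt_le_trans _ h)// invr_gt0.
have -> : genus1_factor u - 1 = (1 + u)^-1 * (cexp u - 1 - u).
  by rewrite /genus1_factor; field.
rewrite nrmM nrmV.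
have -> : 16 * nrm u ^+ 2 = 2 * (8 * nrm u ^+ 2) :> R by ring.
apply: ler_pM; rewrite ?invr_ge0 ?nrm_ge0 ?cexpB1B_le//.
rewrite -[leRHS]invrK lef_pV2// posrE; last by rewrite invr_gt0.
by rewrite (lt_le_trans _ h)// invr_gt0.
Qed.

Lemma genus1_factor_decay2 z h : gamma_regular z ->
  decay2 (fun k => genus1_factor (h * (z + k%:R)^-1) - 1).
Proof.
move=> /inv_shift_le[B B1 hB].
pose K := Num.truncn (2 * (nrm h * B)).
apply: (@decay2_eventually _ _ (16 * (nrm h * B) ^+ 2) K) => k Kk.
have kp : 0 < k.+1%:R :> R by rewrite ltr0n.
have hk : nrm (h * (z + k%:R)^-1) <= nrm h * B / k.+1%:R.
  by rewrite nrmM -mulrA ler_wpM2l ?nrm_ge0.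
have small : nrm (h * (z + k%:R)^-1) <= 2^-1.
  apply: (le_trans hk); rewrite ler_pdivrMr// -ler_pdivrMl ?invr_gt0// invrK.
  apply: (le_trans (ltW (truncnS_gt _))); rewrite ler_nat -/K; exact: Kk.
apply: (le_trans (genus1_factor_sub1_le _ small)).
rewrite -mulrA ler_wpM2l// -expr_div_n lerXn2r// ?nnegrE ?nrm_ge0//.
exact: le_trans (nrm_ge0 _) hk.
Qed.

Lemma genus1_prod_cvg z h : gamma_regular z ->
  exists l, (fun n => \prod_(0 <= k < n.+1) genus1_factor (h * (z + k%:R)^-1)) @ \oo --> l.
Proof.
move=> gz; have [l hl] := decay2_prod_cvg _ (genus1_factor_decay2 z h gz).
exists l; move: hl; rewrite -cvg_shiftS => hl; apply: (eq_cvgC _ _ _ hl) => n.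
by apply: eq_bigr => k _; rewrite addrCA subrr addr0.
Qed.

Lemma Gamma_approx1 n : Gamma_approx 1 n.+1 = n.+1%:R / n.+2%:R :> Cplx R.
Proof.
rewrite /Gamma_approx mul1r cexp_toC lnK ?posrE ?ltr0n// toC_nat.
have -> : \prod_(0 <= k < n.+2) ((1 : Cplx R) + k%:R) = n.+2`!%:R.
  rewrite fact_prod natr_prod big_add1 /=; apply: eq_bigr => k _.
  by rewrite addrC natr1.
rewrite (factS n.+1) natrM.
have f0 : (n.+1)`!%:R != 0 :> Cplx R by rewrite pnatr_eq0 -lt0n fact_gt0.
by rewrite (mulrC _ n.+1%:R) -mulf_div divff// mulr1.
Qed.

(** The approximants are explicit at 1; from there convergence spreads to all other points by
    shifting. *)
Lemma Gamma_approx1_cvg : Gamma_approx (1 : Cplx R) @ \oo --> (1 : Cplx R).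
Proof.
rewrite -cvg_shiftS.
have h : (fun n => toC (1 - @harmonic R n.+1)) @ \oo --> (toC 1 : Cplx R).
  apply: cvg_toC; rewrite -[X in _ --> X]subr0.
  apply: (cvgB (cvg_cst _)).
  by rewrite (cvg_shiftS (@harmonic R)); exact: cvg_harmonic.
apply: (eq_cvgC _ _ _ h) => n.
rewrite -[LHS]/(Gamma_approx 1 n.+1) Gamma_approx1 toCB toCV toC_nat toC1.
have n0 : n.+2%:R != 0 :> Cplx R by rewrite pnatr_eq0.
by apply: (mulIf n0); rewrite mulfVK// mulrBl mulVf// mul1r -(natr1 n.+1) addrK.
Qed.

(** Only the base point z must be regular. If w is a pole, both sides of the shift formula
    eventually vanish through 0^-1 = 0. *)
Lemma Gamma_approx_shift_cvg z w l : gamma_regular z -> Gamma_approx z @ \oo --> l ->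
  exists d, Gamma_approx w @ \oo --> l * d.
Proof.
move=> gz hl; have [p hp] := psi_approx_cvg _ gz.
have [q hq] := genus1_prod_cvg _ (w - z) gz.
exists (cexp ((w - z) * p) * q).
have -> : Gamma_approx w = fun n => Gamma_approx z n * (cexp ((w - z) * psi_approx z n) *
    \prod_(0 <= k < n.+1) genus1_factor ((w - z) * (z + k%:R)^-1)).
  apply/funext => n.
  by rewrite -(Gamma_approx_shift z (w - z) n gz) addrC subrK.
exact: (cvgM hl (cvgM (cvg_cexp _ _ (cvgM (cvg_cst _) hp)) hq)).
Qed.

(* At a pole the division by the vanishing product gives 0, so Gamma z = 0 there. *)
Lemma Gamma_cvg z : Gamma_approx z @ \oo --> Gamma z.
Proof.
have [d hd] := Gamma_approx_shift_cvg 1 z 1 (@gamma_regular1 R) Gamma_approx1_cvg.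
by apply: cvgP; apply/cvg_ex; exists (1 * d).
Qed.

(* Shifting from z back to 1 exhibits 1 = Gamma 1 as a multiple of Gamma z. *)
Lemma Gamma_neq0 z : gamma_regular z -> Gamma z != 0.
Proof.
move=> gz; have [d hd] := Gamma_approx_shift_cvg z 1 _ gz (Gamma_cvg z).
have e : 1 = Gamma z * d.
  by rewrite -(cvg_lim _ Gamma_approx1_cvg)// -(cvg_lim _ hd).
by apply/eqP => z0; move/eqP: e; rewrite z0 mul0r oner_eq0.
Qed.

End GammaFunction.

(** * Digamma and polygamma functions *)

Definition psi {R : realType} (z : Cplx R) : Cplx R := limn (psi_approx z).

(* Termwise m-th derivative of psi_approx; ln n survives only for m = 0. *)
Definition psi_approx_derive {R : realType} (m : nat) (z : Cplx R) (n : nat) : Cplx R :=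
  if m is 0%N then psi_approx z n
  else (-1) ^+ m.+1 * m`!%:R * inv_pow_sum m.+1 z n.

Section Polygamma.
Context {R : realType}.
Implicit Types (z w l h a : Cplx R).

Lemma psi_cvg z : gamma_regular z -> psi_approx z @ \oo --> psi z.
Proof.
by move=> /psi_approx_cvg[l hl]; apply: cvgP; apply/cvg_ex; exists l.
Qed.

Lemma inv_shift_sqr_sum_le z : gamma_regular z ->
  exists2 S : R, 0 <= S & forall n, \sum_(0 <= k < n) nrm (z + k%:R)^-1 ^+ 2 <= S.
Proof.
move=> gz; have [S S0 hS] := decay2_sum_le _ (inv_shift_sqr_decay2 z z gz gz).
exists S => // n; apply: le_trans (hS n).
by apply: ler_sum => k _; rewrite nrmM expr2.
Qed.

Lemma small_sqr_le (A r : R) : 1 <= A -> 0 <= r -> r * A <= 64^-1 ->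
  (r <= 64^-1) * (r ^+ 2 * A <= 64^-1 ^+ 2).
Proof. by move=> A1 r0 rA; split; nra. Qed.

Lemma expR_sub1_le (x : R) : 0 <= x -> x <= 2^-1 -> expR x - 1 <= 2 * x.
Proof.
move=> x0 x1.
have h : `|expR x - 1 - x| <= 2 * x ^+ 2 by apply: expRB1_le; rewrite ger0_norm.
by move: h; rewrite ler_norml => /andP[_ h]; nra.
Qed.

(** The bound is uniform in n: the factors differ from 1 by a total of at most 16 A |h|^2, and e^x -
    1 <= 2x doubles the constant. *)
Lemma genus1_prod_sub1_le z h (A : R) n :
  (forall k, nrm (z + k%:R)^-1 <= A) ->
  (forall n, \sum_(0 <= k < n) nrm (z + k%:R)^-1 ^+ 2 <= A) ->
  1 <= A -> nrm h * A <= 64^-1 ->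
  nrm (\prod_(0 <= k < n) genus1_factor (h * (z + k%:R)^-1) - 1) <=
    32 * A * nrm h ^+ 2.
Proof.
move=> hA hS A1 hh; have h0 := nrm_ge0 h.
have [h1 h2] := small_sqr_le _ _ A1 h0 hh.
pose w k := genus1_factor (h * (z + k%:R)^-1) - 1.
have -> : \prod_(0 <= k < n) genus1_factor (h * (z + k%:R)^-1) = \prod_(0 <= k < n) (1 + w k).
  by apply: eq_bigr => k _; rewrite /w addrCA subrr addr0.
have wle : \sum_(0 <= k < n) nrm (w k) <= 16 * nrm h ^+ 2 * A.
  apply: (@le_trans _ _ (16 * nrm h ^+ 2 * \sum_(0 <= k < n) nrm (z + k%:R)^-1 ^+ 2)).
    rewrite mulr_sumr; apply: ler_sum => k _.
    rewrite -mulrA -exprMn -nrmM; apply: genus1_factor_sub1_le.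
    rewrite nrmM; have := hA k; have := nrm_ge0 (z + k%:R)^-1; nra.
  by rewrite ler_wpM2l// mulr_ge0// exprn_ge0.
apply: (le_trans (prod_sub1_nrm _ _)).
apply: (@le_trans _ _ (expR (16 * nrm h ^+ 2 * A) - 1)).
  by rewrite lerB// ler_expR.
apply: (le_trans (expR_sub1_le _ _ _)).
- by rewrite !mulr_ge0 ?exprn_ge0//; lra.
- by rewrite -mulrA; lra.
- by rewrite le_eqVlt; apply/orP; left; apply/eqP; ring.
Qed.

Lemma derive1_Gamma z : gamma_regular z -> derive1 (@Gamma R) z = Gamma z * psi z.
Proof.
move=> gz.
have [A1 A11 hA1] := inv_shift_bounded _ gz.
have [A2 A20 hA2] := inv_shift_sqr_sum_le _ gz.
have [A3 A30 hA3] := cvgC_bounded _ _ (psi_cvg _ gz).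
have [A4 A40 hA4] := cvgC_bounded _ _ (Gamma_cvg z).
(* One constant dominates |a_k|, the sums of |a_k|^2 and |psi_n(z)|, where a_k = 1/(z + k). *)
pose A := A1 + A2 + A3.
have A_1 : 1 <= A by rewrite /A; lra.
(* The remainder is Gamma_n(z) times (e^u - 1 - u) + e^u (P - 1) with u = h psi_n(z). These are
   bounded by 8 (A |h|)^2 and 4 * 32 A |h|^2, and [A4] bounds Gamma_n(z). *)
apply: (@derive1_limit _ (fun n w => Gamma_approx w n) _
  (fun n => Gamma_approx z n * psi_approx z n) _ _ (A4 * (8 * A ^+ 2 + 128 * A)) ((64 * A)^-1)).
- by rewrite invr_gt0; lra.
- by move=> h _; exact: Gamma_cvg.
- exact: (cvgM (Gamma_cvg z) (psi_cvg _ gz)).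
move=> n h hd; have h0 := nrm_ge0 h.
have hh : nrm h * A <= 64^-1.
  move: hd => /ltW; rewrite -(@ler_pM2r _ A); last lra.
  by rewrite invfM -mulrA mulVf ?mulr1//; apply/eqP; lra.
rewrite Gamma_approx_shift//.
set P := \prod_(_ <= _ < _) _.
have hP : nrm (P - 1) <= 32 * A * nrm h ^+ 2.
  apply: genus1_prod_sub1_le => // [k|m].
    by apply: (le_trans (hA1 k)); rewrite /A; lra.
  by apply: (le_trans (hA2 m)); rewrite /A; lra.
set u := h * psi_approx z n.
have hu : nrm u <= nrm h * A.
  by rewrite nrmM ler_wpM2l// (le_trans (hA3 n))// /A; lra.
have -> : Gamma_approx z n * (cexp u * P) - Gamma_approx z n -
    h * (Gamma_approx z n * psi_approx z n) =
    Gamma_approx z n * ((cexp u - 1 - u) + cexp u * (P - 1)) by rewrite /u; ring.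
have u0 := nrm_ge0 u.
have qu : nrm (cexp u - 1 - u) <= 8 * nrm u ^+ 2 by apply: cexpB1B_le; lra.
have eu : nrm (cexp u) <= 4.
  have -> : cexp u = (cexp u - 1 - u) + (1 + u) by ring.
  have t1 := nrmD (cexp u - 1 - u) (1 + u); have t2 := nrmD 1 u.
  rewrite nrm1 in t2; nra.
rewrite nrmM -mulrA; apply: ler_pM; rewrite ?nrm_ge0//.
apply: (le_trans (nrmD _ _)); rewrite mulrDl; apply: lerD.
  apply: (le_trans qu); rewrite -mulrA ler_wpM2l// -exprMn (mulrC A).
  by rewrite lerXn2r// nnegrE// mulr_ge0//; lra.
rewrite nrmM.
have -> : 128 * A * nrm h ^+ 2 = 4 * (32 * A * nrm h ^+ 2) by ring.
by apply: ler_pM; rewrite ?nrm_ge0.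
Qed.

Lemma digammaE z : gamma_regular z -> digamma z = psi z.
Proof.
by move=> gz; rewrite /digamma derive1_Gamma// mulrC mulKf// Gamma_neq0.
Qed.

(** For a = 1/(z + k), the quotient a/(1 + h a) is 1/(z + h + k). Keeping |a|^2 in the bound makes
    the errors summable over k, uniformly in n. *)
Lemma inv_pow_taylor (A : R) m : 1 <= A -> exists2 C : R, 0 <= C & forall a h,
  nrm a <= A -> nrm h * A <= 2^-1 ->
  nrm ((a / (1 + h * a)) ^+ m - a ^+ m + m%:R * h * a ^+ m.+1) <=
    C * nrm h ^+ 2 * nrm a ^+ 2.
Proof.
move=> A1; elim: m => [|m [C C0 IH]].
  by exists 0 => // a h _ _; rewrite !mul0r !expr0 subrr !add0r nrm0.
exists (2 * A * C + m.+1%:R * A ^+ m * (2 * A)) => [|a h aA hA].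
  by rewrite addr_ge0 ?mulr_ge0 ?exprn_ge0 ?ler0n//; lra.
have a0 := nrm_ge0 a; have h0 := nrm_ge0 h.
have ha : nrm (h * a) <= 2^-1 by rewrite nrmM; nra.
have d1 := nrm_1D_ge _ ha.
have d0 : 1 + h * a != 0 by rewrite -nrm_gt0; lra.
set b := a / (1 + h * a).
have hb : nrm b <= 2 * A.
  rewrite /b nrmM nrmV ler_pdivrMr; last lra.
  by nra.
have -> : b ^+ m.+1 - a ^+ m.+1 + m.+1%:R * h * a ^+ m.+2 =
  b * (b ^+ m - a ^+ m + m%:R * h * a ^+ m.+1) + m.+1%:R * h ^+ 2 * a ^+ m.+2 * b.
  have eb : b * (1 + h * a) = a by rewrite /b mulfVK.
  rewrite -natr1 !exprS; set am := a ^+ m; set bm := b ^+ m.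
  (* The two sides differ by a multiple of a - b (1 + h a), which is zero. *)
  transitivity (b * (bm - am + m%:R * h * (a * am)) + (m%:R + 1) * h ^+ 2 * (a * (a * am)) * b
      + am * (h * a * (m%:R + 1) - 1) * (a - b * (1 + h * a))); first by ring.
  by rewrite eb subrr mulr0 addr0 expr0 mulr1 expr2.
apply: (le_trans (nrmD _ _)).
have -> : (2 * A * C + m.+1%:R * A ^+ m * (2 * A)) * nrm h ^+ 2 * nrm a ^+ 2 =
  (2 * A) * (C * nrm h ^+ 2 * nrm a ^+ 2) +
  m.+1%:R * nrm h ^+ 2 * (A ^+ m * nrm a ^+ 2) * (2 * A) by ring.
apply: lerD; first by rewrite nrmM; apply: ler_pM; rewrite ?nrm_ge0//; exact: IH.
rewrite (nrmM _ b) (nrmM _ (a ^+ _)) (nrmM _ (h ^+ _)) nrm_nat !nrmX -(addn2 m) exprD.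
have am : nrm a ^+ m <= A ^+ m by rewrite lerXn2r// nnegrE; lra.
by rewrite ler_pM ?nrm_ge0 ?mulr_ge0 ?exprn_ge0 ?ler_wpM2l ?ler_wpM2r ?mulr_ge0 ?exprn_ge0.
Qed.

Lemma psi_approx_derive_cvg m z : gamma_regular z ->
  exists l, psi_approx_derive m z @ \oo --> l.
Proof.
case: m => [|m] gz; first exact: psi_approx_cvg.
have [l hl] := inv_pow_sum_cvg _ m.+2 gz isT.
exists ((-1) ^+ m.+2 * m.+1`!%:R * l).
exact: (cvgM (cvg_cst _) hl).
Qed.

(** The ln n present for m = 0 cancels in the difference, so one formula covers all m. *)
Lemma psi_approx_derive_sub m z h n :
  psi_approx_derive m (z + h) n - psi_approx_derive m z n - h * psi_approx_derive m.+1 z n =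
  (-1) ^+ m.+1 * m`!%:R * \sum_(0 <= k < n.+1) ((z + h + k%:R)^-1 ^+ m.+1 -
     (z + k%:R)^-1 ^+ m.+1 + m.+1%:R * h * (z + k%:R)^-1 ^+ m.+2).
Proof.
rewrite big_split/= sumrB -mulr_sumr.
rewrite -/(inv_pow_sum m.+1 (z + h) n) -/(inv_pow_sum m.+1 z n) -/(inv_pow_sum m.+2 z n).
case: m => [|m]; rewrite /psi_approx_derive /psi_approx.
  by rewrite !fact0 !expr1 expr2 (factS 0) fact0; ring.
by rewrite (factS m.+1) natrM [(-1) ^+ m.+3]exprS; ring.
Qed.

(** The induction runs over all regular z at once, since differentiating at z uses the previous
    order on a whole disc around z. *)
Lemma polygamma_cvg m z : gamma_regular z ->
  psi_approx_derive m z @ \oo --> polygamma m z.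
Proof.
elim: m z => [|m IH] z gz; first by rewrite /polygamma /= digammaE//; exact: psi_cvg.
have [l hl] := psi_approx_derive_cvg m.+1 _ gz.
suff -> : polygamma m.+1 z = l by [].
have [A A1 hA] := inv_shift_bounded _ gz.
have [S S0 hS] := inv_shift_sqr_sum_le _ gz.
have [C C0 hC] := inv_pow_taylor A m.+1 A1.
have hd h : nrm h < (2 * A)^-1 -> nrm h * A <= 2^-1.
  move=> /ltW; rewrite -(@ler_pM2r _ A); last lra.
  by rewrite invfM -mulrA mulVf ?mulr1//; apply/eqP; lra.
have -> : polygamma m.+1 z = derive1 (@polygamma R m) z by rewrite /polygamma derive1nS.
apply: (@derive1_limit _ (fun n w => psi_approx_derive m w n) (@polygamma R m)
  (psi_approx_derive m.+1 z) z l (m`!%:R * (C * S)) ((2 * A)^-1)).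
- by rewrite invr_gt0; lra.
- by move=> h /hd hh; apply: IH; exact: gamma_regular_near hA hh.
- exact: hl.
move=> n h /hd hh; rewrite psi_approx_derive_sub !nrmM nrmX nrmN nrm1 expr1n mul1r nrm_nat.
rewrite -mulrA ler_wpM2l//; apply: (le_trans (nrm_sum _ _ _ _)).
apply: (@le_trans _ _ (\sum_(0 <= k < n.+1) C * nrm h ^+ 2 * nrm (z + k%:R)^-1 ^+ 2)).
  apply: ler_sum => k _; rewrite shift_factor// invfM.
  exact: hC.
rewrite -mulr_sumr mulrAC ler_wpM2r ?exprn_ge0 ?nrm_ge0//.
by rewrite ler_wpM2l.
Qed.

End Polygamma.

(** * The finite identity *)

Section FiniteIdentity.
Context {F : numFieldType}.

Lemma sum_delta0 q (u : nat -> F) : \sum_(0 <= k < q.+1) (k == 0%N)%:R * u k = u 0%N.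
Proof.
rewrite big_nat_recl//= mul1r big1 ?addr0// => k _; exact: mul0r.
Qed.

(** Applied with c = - H_N to the finite sums and with c = - gamma to their limits. *)
Lemma convolution_shift0 q (x : nat -> F) (c : F) :
  \sum_(0 <= k < q.+1)
    (x k + (k == 0%N)%:R * c) * (x (q - k)%N + (q - k == 0)%N%:R * c) =
  \sum_(0 <= k < q.+1) x k * x (q - k)%N + 2 * c * x q + (q == 0%N)%:R * c ^+ 2.
Proof.
have -> : \sum_(0 <= k < q.+1)
    (x k + (k == 0%N)%:R * c) * (x (q - k)%N + (q - k == 0)%N%:R * c) =
  \sum_(0 <= k < q.+1) x k * x (q - k)%N +
  \sum_(0 <= k < q.+1) (k == 0%N)%:R * (c * (x (q - k)%N + (q - k == 0)%N%:R * c)) +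
  \sum_(0 <= k < q.+1) (q - k == 0)%N%:R * (c * x k).
  by rewrite -!big_split/=; apply: eq_bigr => k _; ring.
rewrite sum_delta0 subn0.
have -> : \sum_(0 <= k < q.+1) (q - k == 0)%N%:R * (c * x k) =
    \sum_(0 <= k < q.+1) (k == 0%N)%:R * (c * x (q - k)%N).
  rewrite big_nat_rev/= add0n; apply: eq_big_nat => k /andP[_ kq].
  by rewrite subSS subKn.
rewrite sum_delta0 subn0; ring.
Qed.

Lemma geometric_convolution (x y : F) q :
  (x - y) * \sum_(0 <= i < q.+1) x ^+ i.+1 * y ^+ (q - i).+1 =
  x * y * (x ^+ q.+1 - y ^+ q.+1).
Proof.
rewrite subrXX big_mkord mulrCA; congr (_ * _); rewrite mulr_sumr.
rewrite [in RHS](reindex_inj rev_ord_inj)/=; apply: eq_bigr => i _.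
have iq : (i <= q)%N by rewrite -ltnS.
by rewrite subSS subKn// !exprS; ring.
Qed.

(** The term l = k is 0^-1 = 0; indices above k contribute H_m and those below contribute - H_k. *)
Lemma sum_inv_sub (k m : nat) :
  \sum_(0 <= l < (k + m).+1) (l%:R - k%:R)^-1 =
  harmonic_number F m - harmonic_number F k.
Proof.
elim: m => [|m IH]; last first.
  rewrite addnS big_nat_recr//= IH harmonic_numberS addrAC; congr (_ - _).
  by congr (_ + _^-1); rewrite -addnS natrD addrC addKr.
have H0 : harmonic_number F 0 = 0 by rewrite /harmonic_number big_geq.
rewrite addn0 H0 sub0r; elim: k => [|k IH].
  by rewrite big_nat1 subrr invr0 H0 oppr0.
rewrite big_nat_recl//= sub0r invrN harmonic_numberS opprD addrC; congr (_ + _).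
by rewrite -IH; apply: eq_bigr => l _; rewrite -!natr1 opprD addrACA subrr addr0.
Qed.

(* The second hypothesis is the identity satisfied by a_k = 1 / (z + k). It turns
   the off-diagonal terms of the convolution into (a_k^p - a_l^p) / (l - k),
   whose sum over l gives harmonic numbers. *)
Lemma power_sum_convolution (a : nat -> F) q N :
  (forall k, a k != 0) -> (forall k l, a k - a l = a k * a l * (l%:R - k%:R)) ->
  \sum_(0 <= i < q.+1) (\sum_(0 <= k < N.+1) a k ^+ i.+1) *
                       (\sum_(0 <= k < N.+1) a k ^+ (q - i).+1) =
  q.+1%:R * \sum_(0 <= k < N.+1) a k ^+ q.+2 +
  2 * \sum_(0 <= k < N.+1) a k ^+ q.+1 *
        (harmonic_number F (N - k) - harmonic_number F k).
Proof.
move=> a0 adiff.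
pose D (k l : nat) : F := (l%:R - k%:R)^-1.
have term k l : \sum_(0 <= i < q.+1) a k ^+ i.+1 * a l ^+ (q - i).+1 =
    (k == l)%:R * (q.+1%:R * a k ^+ q.+2) + (a k ^+ q.+1 - a l ^+ q.+1) * D k l.
  have [<-|kl] := eqVneq k l.
    rewrite subrr mul0r addr0 mul1r.
    rewrite (eq_big_nat _ _ (F2 := fun _ => a k ^+ q.+2)).
      by rewrite sumr_const_nat subn0 mulr_natl.
    by move=> i /andP[_ iq]; rewrite -exprD addSn addnS subnKC.
  have d0 : l%:R - k%:R != 0 :> F by rewrite subr_eq0 eqr_nat eq_sym.
  rewrite mul0r add0r; apply: (mulIf d0); rewrite mulfVK//.
  apply: (mulfI (mulf_neq0 (a0 k) (a0 l))).
  by rewrite -geometric_convolution adiff; ring.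
have -> : \sum_(0 <= i < q.+1) (\sum_(0 <= k < N.+1) a k ^+ i.+1) *
    (\sum_(0 <= k < N.+1) a k ^+ (q - i).+1) =
  \sum_(0 <= k < N.+1) \sum_(0 <= l < N.+1) \sum_(0 <= i < q.+1) a k ^+ i.+1 * a l ^+ (q - i).+1.
  under eq_bigr => i _ do rewrite mulr_suml.
  rewrite exchange_big/=; apply: eq_bigr => k _.
  under eq_bigr => i _ do rewrite mulr_sumr.
  by rewrite exchange_big.
under eq_bigr => k _ do under eq_bigr => l _ do rewrite term.
under eq_bigr => k _ do rewrite big_split/=.
rewrite big_split/=; congr (_ + _).
  rewrite mulr_sumr; apply: eq_big_nat => k kN.
  rewrite (bigD1_seq k) ?iota_uniq ?mem_index_iota//= eqxx mul1r big1 ?addr0//.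
  by move=> l lk; rewrite eq_sym (negbTE lk) mul0r.
(* [D] is antisymmetric, so exchanging k and l turns the second half of the sum into the first; this
   is the factor 2. *)
have -> : \sum_(0 <= k < N.+1) \sum_(0 <= l < N.+1) (a k ^+ q.+1 - a l ^+ q.+1) * D k l =
    \sum_(0 <= k < N.+1) a k ^+ q.+1 * (\sum_(0 <= l < N.+1) D k l) +
    \sum_(0 <= k < N.+1) a k ^+ q.+1 * (\sum_(0 <= l < N.+1) D k l).
  under eq_bigr => k _ do (under eq_bigr => l _ do rewrite mulrBl; rewrite sumrB).
  rewrite sumrB; congr (_ + _).
    by apply: eq_bigr => k _; rewrite mulr_sumr.
  rewrite exchange_big/= -sumrN; apply: eq_bigr => l _.
  rewrite mulr_sumr -sumrN; apply: eq_bigr => k _.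
  by rewrite -mulrN /D -invrN opprB.
rewrite (eq_big_nat _ _ (F2 := fun k => a k ^+ q.+1 *
  (harmonic_number F (N - k) - harmonic_number F k))); first by ring.
move=> k /andP[_]; rewrite ltnS => kN.
by rewrite -{1}(subnKC kN) sum_inv_sub.
Qed.

End FiniteIdentity.

(** * Differences of harmonic numbers against terms of order 1/k^2 *)

Section HarmonicRemainder.
Context {R : realType}.

Lemma harmonic_number_sub_ge0 (m k : nat) :
  0 <= harmonic_number R (m + k) - harmonic_number R m.
Proof.
elim: k => [|k IH]; first by rewrite addn0 subrr.
by rewrite addnS harmonic_numberS addrAC addr_ge0// invr_ge0.
Qed.

Lemma harmonic_number_sub_le (m k : nat) :
  harmonic_number R (m + k) - harmonic_number R m <= k%:R / m.+1%:R.
Proof.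
elim: k => [|k IH]; first by rewrite addn0 subrr mul0r.
rewrite addnS harmonic_numberS addrAC -(natr1 k) mulrDl mul1r lerD//.
by rewrite lef_pV2 ?posrE ?ltr0n// ler_nat ltnS leq_addr.
Qed.

(** Use 1/(xy) = (1/x + 1/y)/(x + y) with x + y = N + 2; each of the two sums is H_(N+1). *)
Lemma sum_inv_mul_rev N :
  \sum_(0 <= k < N.+1) (k.+1%:R * (N - k).+1%:R)^-1 =
  2 * harmonic_number R N.+1 / N.+2%:R.
Proof.
rewrite mulr_natl mulr2n.
have e : harmonic_number R N.+1 = \sum_(0 <= k < N.+1) (N - k).+1%:R^-1.
  rewrite harmonic_numberE big_nat_rev/= add0n; apply: eq_big_nat => k /andP[_ kN].
  by rewrite subSS.
rewrite {1}harmonic_numberE {}e -big_split/= mulr_suml; apply: eq_big_nat => k /andP[_ kN].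
have -> : N.+2%:R = k.+1%:R + (N - k).+1%:R :> R.
  by rewrite -natrD addSn addnS subnKC.
have p1 : 0 < k.+1%:R :> R by rewrite ltr0n.
have p2 : 0 < (N - k).+1%:R :> R by rewrite ltr0n.
move: (k.+1%:R : R) ((N - k).+1%:R : R) p1 p2 => x y p1 p2.
by field; rewrite !gt_eqF ?addr_gt0.
Qed.

Lemma harmonic_mean_cvg0 : (fun N => harmonic_number R N.+1 / N.+2%:R) @ \oo --> (0 : R).
Proof.
apply: (@squeeze_cvgr _ _ _ _ (fun=> 0) (arithmetic_mean (@harmonic R))); last 2 first.
- exact: cvg_cst.
- exact: cesaro (@cvg_harmonic R).
apply: nearW => N; rewrite /arithmetic_mean /= seriesEnat /= -harmonic_numberE.
have h0 : 0 <= harmonic_number R N.+1 by apply: sumr_ge0 => i _; rewrite invr_ge0.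
rewrite mulr_ge0 ?invr_ge0//= mulrC ler_wpM2r//.
by rewrite lef_pV2 ?posrE ?ltr0n// ler_nat.
Qed.

(** Since H_N - H_(N-k) <= k/(N - k + 1), the terms are at most C/((k + 1)(N - k + 1)), with sum 2 C
    H_(N+1)/(N + 2). *)
Lemma harmonic_remainder_cvg0 (u : nat -> Cplx R) : decay2 u ->
  (fun N => \sum_(0 <= k < N.+1) u k *
     (harmonic_number (Cplx R) N - harmonic_number (Cplx R) (N - k))) @ \oo --> (0 : Cplx R).
Proof.
move=> [C hC]; have C0 : 0 <= C.
  by have := le_trans (nrm_ge0 _) (hC 0%N); rewrite expr1n divr1.
apply: (@cvgC_le _ _ _ (fun N => C * 2 * (harmonic_number R N.+1 / N.+2%:R))) => [N|]; last first.
  by rewrite -[X in _ --> X](mulr0 (C * 2)); exact: (cvgM (cvg_cst _) harmonic_mean_cvg0).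
rewrite subr0 -mulrA (mulrA 2) -sum_inv_mul_rev mulr_sumr.
apply: (le_trans (nrm_sum _ _ _ _)); apply: ler_sum_nat => k /andP[_]; rewrite ltnS => kN.
rewrite nrmM -!toC_harmonic -toCB nrm_toC.
rewrite -{1}(subnK kN) ger0_norm ?harmonic_number_sub_ge0//.
have p1 : 0 < k.+1%:R :> R by rewrite ltr0n.
have p2 : 0 < (N - k).+1%:R :> R by rewrite ltr0n.
apply: (@le_trans _ _ (C / k.+1%:R ^+ 2 * (k.+1%:R / (N - k).+1%:R))).
  apply: ler_pM; rewrite ?nrm_ge0 ?harmonic_number_sub_ge0//.
  apply: (le_trans (harmonic_number_sub_le _ _)).
  by rewrite ler_wpM2r ?invr_ge0// ler_nat.
rewrite le_eqVlt; apply/orP; left; apply/eqP.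
move: (k.+1%:R : R) ((N - k).+1%:R : R) p1 p2 => x y p1 p2.
by field; rewrite !gt_eqF.
Qed.

End HarmonicRemainder.

(** * Limits of the sums of H_k/(t + k)^p after renormalization *)

Section ShiftedHarmonicSums.
Context {R : realType}.
Implicit Types (t z l : Cplx R).

Lemma cvgC_sum (I : eqType) (s : seq I) (u : I -> nat -> Cplx R) (l : I -> Cplx R) :
  (forall i, i \in s -> u i @ \oo --> l i) ->
  (fun n => \sum_(i <- s) u i n) @ \oo --> \sum_(i <- s) l i.
Proof.
elim: s => [|i s IH] h.
  rewrite big_nil; apply: (eq_cvgC _ _ _ (cvg_cst 0)) => n.
  by rewrite big_nil.
rewrite big_cons.
have h1 : u i @ \oo --> l i by apply: h; rewrite mem_head.
have h2 : (fun n => \sum_(j <- s) u j n) @ \oo --> \sum_(j <- s) l j.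
  by apply: IH => j js; apply: h; rewrite inE js orbT.
by apply: (eq_cvgC _ _ _ (cvgD h1 h2)) => n; rewrite big_cons.
Qed.

(* The sum of the 1 / (t + k) diverges; subtracting H_N makes it converge to
   - psi(t) - gamma. *)
Definition renormalized_sum (t : Cplx R) (k N : nat) : Cplx R :=
  inv_pow_sum k.+1 t N - (k == 0%N)%:R * harmonic_number (Cplx R) N.

Definition main_part (t : Cplx R) (q N : nat) : Cplx R :=
  2^-1 * (q.+1%:R * inv_pow_sum q.+2 t N -
    \sum_(0 <= k < q.+1) renormalized_sum t k N * renormalized_sum t (q - k) N).

(** Writing H_(N-k) = H_N - (H_N - H_(N-k)) in the finite identity produces H_N S_(q+1), exactly the
    cross term created by subtracting H_N from S_1. Only for q = 0 does a square of H_N remain. *)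
Lemma harmonic_sum_decomposition t q N : gamma_regular t ->
  \sum_(0 <= k < N.+1) (t + k%:R)^-1 ^+ q.+1 * harmonic_number (Cplx R) k =
  main_part t q N
  - \sum_(0 <= k < N.+1) (t + k%:R)^-1 ^+ q.+1 *
      (harmonic_number (Cplx R) N - harmonic_number (Cplx R) (N - k))
  + (q == 0%N)%:R * (harmonic_number (Cplx R) N ^+ 2 / 2).
Proof.
move=> gt; set H := harmonic_number (Cplx R) N.
pose a k := (t + k%:R)^-1.
have a0 k : a k != 0 by rewrite invr_eq0.
have adiff k (l : nat) : a k - a l = a k * a l * (l%:R - k%:R).
  rewrite /a; have gk := gt k; have gl := gt l; by field; rewrite gk gl.
have conv := @power_sum_convolution (Cplx R) a q N a0 adiff.
have := sumrB (index_iota 0 N.+1) xpredT (fun k => a k ^+ q.+1 * harmonic_number (Cplx R) (N - k))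
  (fun k => a k ^+ q.+1 * harmonic_number (Cplx R) k).
under eq_bigr => k _ do rewrite -mulrBr; move=> esplit; rewrite {}esplit in conv.
have -> : \sum_(0 <= k < N.+1) (t + k%:R)^-1 ^+ q.+1 *
      (H - harmonic_number (Cplx R) (N - k)) =
    H * inv_pow_sum q.+1 t N -
    \sum_(0 <= k < N.+1) a k ^+ q.+1 * harmonic_number (Cplx R) (N - k).
  rewrite /inv_pow_sum mulr_sumr -sumrB; apply: eq_bigr => k _.
  by rewrite mulrBr mulrC.
have conv2 := @convolution_shift0 (Cplx R) q (fun k => inv_pow_sum k.+1 t N) (- H).
rewrite /main_part /renormalized_sum.
have -> : \sum_(0 <= k < q.+1)
   (inv_pow_sum k.+1 t N - (k == 0%N)%:R * H) *
   (inv_pow_sum (q - k).+1 t N - ((q - k)%N == 0%N)%:R * H) =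
  q.+1%:R * inv_pow_sum q.+2 t N +
    2 * (\sum_(0 <= k < N.+1) a k ^+ q.+1 * harmonic_number (Cplx R) (N - k)
    - \sum_(0 <= k < N.+1) a k ^+ q.+1 * harmonic_number (Cplx R) k)
   - 2 * H * inv_pow_sum q.+1 t N + (q == 0%N)%:R * H ^+ 2.
  under eq_bigr => k _ do rewrite -!mulrN.
  rewrite conv2 -/(inv_pow_sum q.+2 t N) conv.
  by rewrite -/(inv_pow_sum q.+2 t N) sqrrN; ring.
by rewrite -/a; field.
Qed.

(** At regular t this is the Hurwitz zeta value zeta(k + 1, t) for k >= 1, and - psi(t) for k = 0;
    the constant gamma is kept apart. *)
Definition renormalized_limit (t : Cplx R) (k : nat) : Cplx R :=
  (-1) ^+ k.+1 / k`!%:R * polygamma k t.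

Lemma fact_neq0 k : k`!%:R != 0 :> Cplx R.
Proof. by rewrite pnatr_eq0 -lt0n fact_gt0. Qed.

Lemma inv_pow_sum_cvg_polygamma t k : gamma_regular t ->
  inv_pow_sum k.+2 t @ \oo --> renormalized_limit t k.+1.
Proof.
move=> gt; pose c : Cplx R := (-1) ^+ k.+2 / k.+1`!%:R.
apply: (eq_cvgC _ _ _ (cvgM (cvg_cst c) (polygamma_cvg k.+1 _ gt))) => n.
rewrite -[RHS]/(c * ((-1) ^+ k.+2 * k.+1`!%:R * inv_pow_sum k.+2 t n)).
have f0 := fact_neq0 k.+1.
rewrite /c; set s := (-1) ^+ k.+2; have ss : s * s = 1 by rewrite -expr2 sqrr_sign.
by transitivity (s * s * inv_pow_sum k.+2 t n); [rewrite ss mul1r | field].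
Qed.

Lemma renormalized_sum_cvg t k : gamma_regular t ->
  renormalized_sum t k @ \oo -->
    renormalized_limit t k + (k == 0%N)%:R * - toC (euler_gamma R).
Proof.
move=> gt; case: k => [|k]; last first.
  rewrite mul0r addr0; apply: (eq_cvgC _ _ _ (inv_pow_sum_cvg_polygamma _ k gt)) => n.
  by rewrite /renormalized_sum mul0r subr0.
have -> : renormalized_limit t 0 + (0 == 0)%N%:R * - toC (euler_gamma R) =
    - psi t - toC (euler_gamma R).
  by rewrite /renormalized_limit /polygamma /= digammaE// fact0 expr1 divr1 mulN1r mul1r.
apply: (eq_cvgC _ _ _ (cvgB (cvgN (psi_cvg _ gt)) (cvg_toC _ _ (@euler_gamma_cvg R)))) => n.
rewrite -[RHS]/(- (toC (ln n%:R) - inv_pow_sum 1 t n) - toC (harmonic_number R n - ln n%:R)).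
by rewrite toCB toC_harmonic /renormalized_sum eqxx mul1r; ring.
Qed.

(** Dividing C(q, k) by q! gives 1/(k! (q - k)!), and the signs multiply to (-1)^q, so the binomial
    sum in [T] is a plain convolution. *)
Lemma T_renormalized t q :
  T t q.+1 = 2^-1 * (q.+1%:R * renormalized_limit t q.+1 -
    \sum_(0 <= k < q.+1) renormalized_limit t k * renormalized_limit t (q - k) +
    2 * toC (euler_gamma R) * renormalized_limit t q).
Proof.
rewrite /T -[q.+1.-1]/q /renormalized_limit.
have fq := fact_neq0 q.
have -> : \sum_(0 <= k < q.+1) ((-1) ^+ k.+1 / k`!%:R * polygamma k t *
      ((-1) ^+ (q - k).+1 / (q - k)`!%:R * polygamma (q - k) t)) =
   (-1) ^+ q / q`!%:R * \sum_(0 <= k < q.+1) 'C(q, k)%:R * polygamma k t * polygamma (q - k) t.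
  rewrite mulr_sumr; apply: eq_big_nat => k /andP[_]; rewrite ltnS => kq.
  have fk := fact_neq0 k; have fqk := fact_neq0 (q - k).
  have eb : 'C(q, k)%:R = q`!%:R / (k`!%:R * (q - k)`!%:R) :> Cplx R.
    rewrite -(bin_fact kq) !natrM mulfK//; exact: mulf_neq0.
  have es : (-1) ^+ q = (-1) ^+ k.+1 * (-1) ^+ (q - k).+1 :> Cplx R.
    by rewrite -exprD addSn addnS subnKC// !exprS; ring.
  by rewrite eb es; field; rewrite fq fk fqk.
have -> : q.+1%:R * ((-1) ^+ q.+2 / (q.+1)`!%:R * polygamma q.+1 t) =
    (-1) ^+ q / q`!%:R * polygamma q.+1 t.
  have q0 : q.+1%:R != 0 :> Cplx R by rewrite pnatr_eq0.
  rewrite factS natrM !exprS; move: (q.+1%:R : Cplx R) q0 => x x0.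
  by field; rewrite x0 fq.
rewrite exprS; set S := \sum_(_ <= _ < _) _; by field.
Qed.

(** Shifting the k = 0 limit by - gamma creates the term of [T] linear in gamma, and an excess
    gamma^2 when q = 0. *)
Lemma main_part_cvg t q : gamma_regular t ->
  main_part t q @ \oo --> T t q.+1 - (q == 0%N)%:R * (toC (euler_gamma R) ^+ 2 / 2).
Proof.
move=> gt; set g := toC (euler_gamma R).
have e : T t q.+1 - (q == 0%N)%:R * (g ^+ 2 / 2) =
  2^-1 * (q.+1%:R * renormalized_limit t q.+1 - \sum_(0 <= k < q.+1)
    (renormalized_limit t k + (k == 0%N)%:R * - g) *
    (renormalized_limit t (q - k) + (q - k == 0)%N%:R * - g)).
  by rewrite convolution_shift0 T_renormalized -/g sqrrN; field.
rewrite e; apply: (cvgM (cvg_cst _)); apply: cvgB.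
  exact: (cvgM (cvg_cst _) (inv_pow_sum_cvg_polygamma _ q gt)).
apply: cvgC_sum => k _.
exact: (cvgM (renormalized_sum_cvg _ k gt) (renormalized_sum_cvg _ (q - k) gt)).
Qed.

End ShiftedHarmonicSums.

(** * Partial fractions *)

Section ResidueSum.
Context {R : realType}.
Implicit Types (t z l : Cplx R).

Lemma cvg_natV : (fun n => n.+1%:R^-1 : Cplx R) @ \oo --> (0 : Cplx R).
Proof.
have h := cvg_toC _ _ (@cvg_harmonic R).
by apply: (eq_cvgC _ _ _ h) => n; rewrite /harmonic toCV toC_nat.
Qed.

Lemma cvgC_exp (u : nat -> Cplx R) l i : u @ \oo --> l -> (fun n => u n ^+ i) @ \oo --> l ^+ i.
Proof.
move=> ul; elim: i => [|i IH]; first by rewrite expr0; exact: cvg_cst.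
by rewrite exprS; apply: (eq_cvgC _ _ _ (cvgM ul IH)) => n; rewrite exprS.
Qed.

Lemma horner_nat_cvg (P : {poly Cplx R}) m : (size P <= m.+1)%N ->
  (fun n => P.[n.+1%:R] / n.+1%:R ^+ m) @ \oo --> P`_m.
Proof.
move=> sP.
have -> : P`_m = \sum_(0 <= i < m.+1) P`_i * 0 ^+ (m - i).
  rewrite big_nat_recr//= subnn expr0 mulr1 big_nat big1 ?add0r// => i /andP[_ im].
  by rewrite expr0n subn_eq0 leqNgt im mulr0.
apply: (@eq_cvgC _ (fun n => \sum_(0 <= i < m.+1) P`_i * n.+1%:R^-1 ^+ (m - i))).
  apply: cvgC_sum => i _; exact: (cvgM (cvg_cst P`_i) (cvgC_exp _ _ _ cvg_natV)).
move=> n; rewrite (horner_coef_wide _ sP) big_mkord mulr_suml.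
apply: eq_bigr => i _; have im : (i <= m)%N by rewrite -ltnS.
have n0 : n.+1%:R != 0 :> Cplx R by rewrite pnatr_eq0.
rewrite -mulrA; congr (_ * _); apply: (mulIf (expf_neq0 m n0)).
rewrite mulfVK ?expf_neq0//.
have -> : n.+1%:R ^+ m = n.+1%:R ^+ (m - i) * n.+1%:R ^+ i :> Cplx R by rewrite -exprD subnK.
by rewrite mulrA -exprMn mulVf// expr1n mul1r.
Qed.

(** Divide both X P and Q by n^m with m = deg Q: the first tends to 0, the second to the leading
    coefficient of Q. Hence Q is nonzero at all large n, where f is prescribed. *)
Lemma rational_gap2_cvg0 (f : Cplx R -> Cplx R) : rational_with_degree_gap 2 f ->
  (fun n => n.+1%:R * f n.+1%:R) @ \oo --> (0 : Cplx R).
Proof.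
move=> [P [Q [Q0 sPQ fE]]].
pose m := (size Q).-1.
have sQ : size Q = m.+1 by rewrite /m prednK// size_poly_gt0.
have lQ : Q`_m != 0 by rewrite -/(lead_coef Q) lead_coef_eq0.
have hQ := horner_nat_cvg Q m; rewrite sQ leqnn in hQ; have {}hQ := hQ isT.
have sXP : (size ('X * P)%R <= m)%N.
  apply: (leq_trans (size_polyMleq _ _)); rewrite size_polyX /=.
  by move: sPQ; rewrite sQ addn2.
have hP := horner_nat_cvg ('X * P) m (leq_trans sXP (leqnSn _)).
rewrite (nth_default _ sXP) in hP.
have hg : (fun n => ('X * P).[n.+1%:R] / n.+1%:R ^+ m * (Q.[n.+1%:R] / n.+1%:R ^+ m)^-1)
    @ \oo --> (0 : Cplx R).
  by rewrite -(mul0r (Q`_m)^-1); exact: (cvgM hP (cvgV lQ hQ)).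
apply: cvg_trans hg; apply: near_eq_cvg.
apply: (filterS _ (@cvgr_neq0 _ _ _ _ _ _ _ hQ lQ)) => n hn.
have n0 : n.+1%:R ^+ m != 0 :> Cplx R by rewrite expf_neq0// pnatr_eq0.
have Qn : Q.[n.+1%:R] != 0 by apply: contra hn => /eqP ->; rewrite mul0r.
rewrite fE// hornerM hornerX; move: (n.+1%:R ^+ m : Cplx R) n0 => x x0.
by field; rewrite x0 Qn.
Qed.

Lemma natmul_inv_pow_cvg t q : gamma_regular t ->
  (fun n => n.+1%:R * (t + n.+1%:R)^-1 ^+ q.+1 : Cplx R) @ \oo --> ((q == 0%N)%:R : Cplx R).
Proof.
move=> gt.
have h1 : (fun n => n.+1%:R * (t + n.+1%:R)^-1) @ \oo --> (1 : Cplx R).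
  have h : (fun n => (t * n.+1%:R^-1 + 1)^-1) @ \oo --> ((t * 0 + 1)^-1 : Cplx R).
    apply: cvgV; first by rewrite mulr0 add0r oner_neq0.
    exact: (cvgD (cvgM (cvg_cst t) cvg_natV) (cvg_cst _)).
  rewrite mulr0 add0r invr1 in h; apply: (eq_cvgC _ _ _ h) => n.
  have n0 : n.+1%:R != 0 :> Cplx R by rewrite pnatr_eq0.
  have -> : t * n.+1%:R^-1 + 1 = (t + n.+1%:R) * n.+1%:R^-1 by rewrite mulrDl divff.
  by rewrite invfM invrK mulrC.
elim: q => [|q IH]; first by apply: (eq_cvgC _ _ _ h1) => n; rewrite expr1.
have -> : (q.+1 == 0%N)%:R = (q == 0%N)%:R * (0 * 1) :> Cplx R by rewrite mul0r mulr0.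
apply: (eq_cvgC _ _ _ (cvgM IH (cvgM cvg_natV h1))) => n.
rewrite -[RHS]/(n.+1%:R * (t + n.+1%:R)^-1 ^+ q.+1 * (n.+1%:R^-1 * (n.+1%:R * (t + n.+1%:R)^-1))).
have n0 : n.+1%:R != 0 :> Cplx R by rewrite pnatr_eq0.
by rewrite mulKf// [in LHS]exprSr mulrA.
Qed.

(* The first-order coefficients sum to lim z f(z), which vanishes by the degree gap. *)
Lemma sum_residues_eq0 (r : nat) (t : 'I_r -> Cplx R) (p : 'I_r -> nat)
    (c : nat -> 'I_r -> Cplx R) (f : Cplx R -> Cplx R) :
  (forall j, gamma_regular (t j)) -> (forall j, (0 < p j)%N) ->
  rational_with_degree_gap 2 f ->
  (forall k, f k%:R = \sum_(j < r) \sum_(0 <= i < p j) c i.+1 j * (t j + k%:R)^-1 ^+ i.+1) ->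
  \sum_(j < r) c 1%N j = 0.
Proof.
move=> gt p0 /rational_gap2_cvg0 hf fE.
have h : (fun n => n.+1%:R * f n.+1%:R) @ \oo -->
    (\sum_(j < r) \sum_(0 <= i < p j) c i.+1 j * (i == 0%N)%:R : Cplx R).
  have hs : (fun n => \sum_(j < r) \sum_(0 <= i < p j)
      c i.+1 j * (n.+1%:R * (t j + n.+1%:R)^-1 ^+ i.+1)) @ \oo -->
    (\sum_(j < r) \sum_(0 <= i < p j) c i.+1 j * (i == 0%N)%:R : Cplx R).
    apply: cvgC_sum => j _; apply: cvgC_sum => i _.
    exact: (cvgM (cvg_cst (c i.+1 j)) (natmul_inv_pow_cvg _ i (gt j))).
  apply: (eq_cvgC _ _ _ hs) => n; rewrite fE mulr_sumr; apply: eq_bigr => j _.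
  by rewrite mulr_sumr; apply: eq_bigr => i _; rewrite mulrCA.
transitivity (\sum_(j < r) \sum_(0 <= i < p j) c i.+1 j * (i == 0%N)%:R); last first.
  by rewrite -[LHS](cvg_lim _ h)// -[RHS](cvg_lim _ hf).
apply: eq_bigr => j _.
case: (p j) (p0 j) => // m _.
rewrite big_nat_recl//= mulr1 big1 ?addr0// => i _; exact: mulr0.
Qed.

Lemma decay2_sum (I : eqType) (s : seq I) (u : I -> nat -> Cplx R) :
  (forall i, i \in s -> decay2 (u i)) -> decay2 (fun k => \sum_(i <- s) u i k).
Proof.
elim: s => [|i s IH] h; first by exists 0 => k; rewrite big_nil nrm0 mul0r.
have [C hC] : decay2 (fun k => u i k + \sum_(j <- s) u j k).
  apply: decay2D; first by apply: h; rewrite mem_head.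
  by apply: IH => j js; apply: h; rewrite inE js orbT.
by exists C => k; rewrite big_cons.
Qed.

Lemma partial_fractions_decay2 (r : nat) (t : 'I_r -> Cplx R) (p : 'I_r -> nat)
    (c : nat -> 'I_r -> Cplx R) :
  (forall j, gamma_regular (t j)) -> (forall j, (0 < p j)%N) -> \sum_(j < r) c 1%N j = 0 ->
  decay2 (fun k => \sum_(j < r) \sum_(0 <= i < p j) c i.+1 j * (t j + k%:R)^-1 ^+ i.+1).
Proof.
move=> gt p0 c0.
(* As the first-order coefficients sum to 0, 1/(k + 1) may be subtracted from each 1/(t_j + k),
   leaving (1 - t_j)/((t_j + k)(k + 1)). *)
pose v k := \sum_(j < r) (c 1%N j * (1 - t j) * ((t j + k%:R)^-1 * (1 + k%:R)^-1) +
  \sum_(1 <= i < p j) c i.+1 j * (t j + k%:R)^-1 ^+ i.+1).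
have [C hC] : decay2 v.
  apply: decay2_sum => j _; apply: decay2D.
    by apply: decay2Ml; exact: inv_shift_sqr_decay2 (@gamma_regular1 R).
  apply: decay2_sum => i; rewrite mem_index_iota => /andP[i1 _].
  by apply: decay2Ml; apply: inv_shift_pow_decay2.
exists C => k; suff -> : \sum_(j < r) \sum_(0 <= i < p j) c i.+1 j * (t j + k%:R)^-1 ^+ i.+1 = v k.
  exact: hC.
have -> : v k = v k + (\sum_(j < r) c 1%N j) * (1 + k%:R)^-1 by rewrite c0 mul0r addr0.
rewrite mulr_suml -big_split/=; apply: eq_bigr => j _.
rewrite big_ltn// expr1 addrAC; congr (_ + _).
have g1 := @gamma_regular1 R k; have gk := gt j k.
by field; rewrite g1 gk.
Qed.

End ResidueSum.

Theorem theorem3 (R : realType) (r : nat) (hr : (1 <= r)%N)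
    (t : 'I_r -> Cplx R) (t_inj : injective t)
    (t_nint : forall (j : 'I_r) (m : int), t j != m%:~R)
    (p : 'I_r -> nat) (hp : forall j, (1 <= p j)%N)
    (hpsum : (2 <= \sum_(j < r) p j)%N)
    (c : nat -> 'I_r -> Cplx R) (hc : forall j, c (p j) j != 0)
    (f : Cplx R -> Cplx R) (hf : rational_with_degree_gap 2 f)
    (f_pfd : forall z : Cplx R, (forall j, z + t j != 0) ->
      f z = \sum_(j < r) \sum_(1 <= i < (p j).+1) c i j / (z + t j) ^+ i) :
  (fun n : nat =>
     \sum_(1 <= k < n.+1) f k%:R * harmonic_number (Cplx R) k : Cplx R) @ \oo
  --> (\sum_(j < r) \sum_(1 <= i < (p j).+1) c i j * T (t j) i : Cplx R).
Proof.
have gt j : gamma_regular (t j).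
  move=> k; rewrite addr_eq0; have := t_nint j (- k%:Z).
  by rewrite rmorphN.
pose H n := harmonic_number (Cplx R) n.
pose u k := \sum_(j < r) \sum_(0 <= i < p j) c i.+1 j * (t j + k%:R)^-1 ^+ i.+1.
have fE k : f k%:R = u k.
  rewrite f_pfd => [|j]; last by rewrite addrC gt.
  apply: eq_bigr => j _; rewrite big_add1; apply: eq_bigr => i _.
  by rewrite exprVn addrC.
have c0 := sum_residues_eq0 r t p c f gt hp hf fE.
have hrem := harmonic_remainder_cvg0 _ (partial_fractions_decay2 r t p c gt hp c0).
have hmain : (fun n => \sum_(j < r) \sum_(0 <= i < p j) c i.+1 j * main_part (t j) i n) @ \oo -->
    (\sum_(j < r) \sum_(0 <= i < p j) c i.+1 j *
      (T (t j) i.+1 - (i == 0%N)%:R * (toC (euler_gamma R) ^+ 2 / 2)) : Cplx R).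
  apply: cvgC_sum => j _; apply: cvgC_sum => i _.
  exact: (cvgM (cvg_cst (c i.+1 j)) (main_part_cvg _ i (gt j))).
(* Serves for both extra terms of order one: the limit gamma^2/2 and the divergent H_n^2/2. *)
have residues (x : Cplx R) :
    \sum_(j < r) \sum_(0 <= i < p j) c i.+1 j * ((i == 0%N)%:R * x) = 0.
  transitivity ((\sum_(j < r) c 1%N j) * x); last by rewrite c0 mul0r.
  rewrite mulr_suml; apply: eq_bigr => j _.
  case: (p j) (hp j) => // m _.
  by rewrite big_nat_recl//= mul1r big1 ?addr0// => i _; rewrite mul0r mulr0.
have -> : \sum_(j < r) \sum_(1 <= i < (p j).+1) c i j * T (t j) i =
  \sum_(j < r) \sum_(0 <= i < p j) c i.+1 j *
      (T (t j) i.+1 - (i == 0%N)%:R * (toC (euler_gamma R) ^+ 2 / 2)) - 0.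
  transitivity (\sum_(j < r) \sum_(1 <= i < (p j).+1) c i j * T (t j) i -
    \sum_(j < r) \sum_(0 <= i < p j) c i.+1 j *
      ((i == 0%N)%:R * (toC (euler_gamma R) ^+ 2 / 2))); first by rewrite residues subr0.
  rewrite subr0 -sumrB.
  apply: eq_bigr => j _; rewrite big_add1 -sumrB; apply: eq_bigr => i _.
  by rewrite mulrBr.
apply: (eq_cvgC _ _ _ (cvgB hmain hrem)) => n.
have -> : \sum_(1 <= k < n.+1) f k%:R * harmonic_number (Cplx R) k =
    \sum_(0 <= k < n.+1) u k * H k.
  (* Since H_0 = 0, the term k = 0 may be added to match [inv_pow_sum]. *)
  have H0 : H 0%N = 0 by rewrite /H /harmonic_number big_geq.
  rewrite [RHS]big_ltn// H0 mulr0 add0r.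
  by apply: eq_bigr => k _; rewrite fE.
rewrite -[RHS]/(\sum_(j < r) \sum_(0 <= i < p j) c i.+1 j * main_part (t j) i n -
  \sum_(0 <= k < n.+1) u k * (H n - H (n - k)%N)).
have swap (v : nat -> Cplx R) : \sum_(0 <= k < n.+1) u k * v k =
    \sum_(j < r) \sum_(0 <= i < p j) c i.+1 j *
      \sum_(0 <= k < n.+1) (t j + k%:R)^-1 ^+ i.+1 * v k.
  rewrite /u; under eq_bigr => k _ do rewrite mulr_suml.
  rewrite exchange_big/=; apply: eq_bigr => j _.
  under eq_bigr => k _ do rewrite mulr_suml.
  rewrite exchange_big/=; apply: eq_bigr => i _.
  by rewrite mulr_sumr; apply: eq_bigr => k _; rewrite mulrA.
(* A zero multiple of H_n^2/2 is inserted, so that the decomposition can be applied separately for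
   each j and i. *)
rewrite -[RHS]addr0 -[X in _ = _ + X](residues (H n ^+ 2 / 2)) !swap -sumrB -big_split/=.
apply: eq_bigr => j _; rewrite -sumrB -big_split/=; apply: eq_bigr => i _.
rewrite harmonic_sum_decomposition; last exact: gt.
by rewrite -mulrBr -mulrDr.
Qed.
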